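(* Consider the Bernoulli model described in the context with $m=m_1=m_2$, and suppose that the noise assumption in the context is satisfied for some $U\ge2$. Let $k=k_{n,m}\to\infty$ be such that $0<k\le m^{1/3}$ and $k^{1/4}\sqrt{m/n}<\min(1,a)/2$. For $0\le k_0<k$ satisfying $k_0=o(k)$ and a sequence $\rho=\rho_{n,m}\in(0,1/2)$ consider the testing problem $$H_0:M\in\mathcal A(a,k_0),\ \sigma^2=1\quad\text{vs}\quad H_1:M\in\mathcal A(a,k),\ \|M-\mathcal A(a,k_0)\|_F^2\ge m^2\rho^2,\ \sigma^2=1-4\rho^2 .$$ If, as $\min(n,m)\to\infty$, $$\rho^2=o\left(\frac{\sqrt k\,m}{n}\right),$$ then for any test $\Psi$ we have $$\liminf_{\min(n,m)\to\infty}\left[\sup_{M\in\mathcal A(a,k_0)}\mathbb E_{M,1}[\Psi]+\sup_{M\in\mathcal A(a,k),\ \|M-\mathcal A(a,k_0)\|_F^2\ge m^2\rho^2}\mathbb E_{M,\sqrt{1-4\rho^2}}[1-\Psi]\right]\ge1 .$$ In particular, if $\Sigma\subset(0,U]$ contains the interval $[\sqrt{1-4\tau},1]$, where $\tau=\limsup_{n,m}k^{1/4}\sqrt{m/n}$, then the testing lower bound (LB) stated in the context holds for the choices $\mathcal A_0=\mathcal A(a,k_0)\otimes\Sigma$, $\mathcal A=\mathcal A(a,k)\otimes\Sigma$, $\beta_0=1$ and $\rho^*=\rho$.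
   Context: Notation. $\|\cdot\|_F$ is the Frobenius norm, $\|A\|_\infty=\max_{i,j}|A_{ij}|$, $\mathcal A(a,k)=\{A\in\mathbb R^{m\times m}:\|A\|_\infty\le a,\ \mathrm{rank}(A)\le k\}$ with $a>0$ (so $\mathcal A(a,0)=\{0\}$; the case $k_0=0$ is allowed), $\|M-\mathcal A(a,k_0)\|_F=\inf_{A\in\mathcal A(a,k_0)}\|M-A\|_F$, and $\mathcal A(a,k)\otimes\Sigma=\{(A,\sigma):A\in\mathcal A(a,k),\sigma\in\Sigma\}$. Bernoulli model (square case). Given $n\le m^2$, put $p=n/m^2$; the $B_{ij}$ are i.i.d. Bernoulli($p$), independent of the noise $(\epsilon_{ij})$, and one observes $Y_{ij}=B_{ij}(M_{ij}+\epsilon_{ij})$ (together with $B_{ij}$) for $1\le i,j\le m$. $\mathbb E_{M,\sigma}$ is the expectation under the law of the data with matrix $M$ and noise variance $\sigma^2$. A test is a $\{0,1\}$-valued function of the data. Noise assumption (with constant $U>0$): the $\epsilon_{ij}$ are independent (not necessarily identically distributed), $\mathbb E\epsilon_{ij}=0$, $\mathbb E\epsilon_{ij}^2=\sigma^2$, and $\max_{i,j}|\epsilon_{ij}|\le U$ almost surely. The noise law is otherwise unspecified and may depend on $M$; suprema over $M$ or $(M,\sigma)$ are understood to range also over the noise laws satisfying this assumption. Testing lower bound (LB). For a parameter set $\mathcal A$ with elements $f$, a subset $\mathcal A_0\subset\mathcal A$, a semi-metric $\mathcal D$ on $\mathcal A$ with $\mathcal D(f,\mathcal A_0)=\inf_{g\in\mathcal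 A_0}\mathcal D(f,g)$, a number $\beta_0>0$ and a sequence $\rho^*$ of non-negative numbers, (LB) is the statement $$\liminf\ \inf_{\Psi}\left[\sup_{f\in\mathcal A_0}\mathbb E_f[\Psi]+\sup_{f\in\mathcal A,\ \mathcal D(f,\mathcal A_0)\ge\rho^*}\mathbb E_f[1-\Psi]\right]\ge\beta_0>0,$$ the infimum being over all tests. Here $f=(M,\sigma)$, $\mathcal D$ is the distance induced by $\|\cdot\|_F$ on the matrix components, and the $\liminf$ is as $\min(n,m)\to\infty$. Asymptotics: $\min(n,m)\to\infty$ with $n\le m^2$; $k,k_0,\rho$ depend on $(n,m)$, and $\limsup_{n,m}$ is taken in this regime. *)

(* Defs.v *)
From HB Require Import structures.
From mathcomp Require Import all_boot all_order all_algebra.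
From mathcomp Require Import all_classical all_reals all_analysis.

Set Implicit Arguments.
Unset Strict Implicit.
Unset Printing Implicit Defensive.

Import Order.TTheory GRing.Theory Num.Theory.
Import numFieldNormedType.Exports.

Local Open Scope classical_set_scope.
Local Open Scope ring_scope.

(* min(n, m) -> +oo along the pairs (n, m) of D.  A side condition such as
   k ^ (1/4) * sqrt (m / n) < 1 / 2 fails whenever 0 < n <= m, hence cannot be
   imposed at all pairs with n <= m ^ 2: D is the set of pairs where it is. *)
Definition regime (D : set (nat * nat)) : set_system (nat * nat) :=
  within D (filter_from [set: nat]
    (fun N => [set nm : nat * nat | (N <= minn nm.1 nm.2)%N])).

#[global] Instance regime_filter (D : set (nat * nat)) : Filter (regime D).
Proof.
apply/within_filter/filter_from_filter; first by exists 0%N.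
move=> i j _ _; exists (maxn i j) => // nm /=; rewrite geq_max.
by move=> /andP[].
Qed.

Canonical regime_filter_on (D : set (nat * nat)) :=
  FilterType (regime D) (regime_filter D).

Section matrices.
Context {R : realType} {m : nat}.
Implicit Types M : 'M[R]_m.

Definition frobenius M : R := Num.sqrt (\sum_i \sum_j M i j ^+ 2).

Definition frobenius_dist M M' : R := frobenius (M - M').

(* mx_norm is the entrywise maximum norm. *)
Definition bounded_low_rank (a : R) (k : nat) : set 'M[R]_m :=
  [set M | mx_norm M <= a /\ (\rank M <= k)%N].

End matrices.

Definition dist_to {R : realType} {X : Type} (D : X -> X -> R) (x : X)
  (A : set X) : R := inf [set D x y | y in A].

(* The product sigma-algebra on matrices with entries in V. *)
Definition mx_sigma {d} {V : measurableType d} {m : nat} :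
    set_system 'M[V]_m :=
  <<s \bigcup_(ij in [set: 'I_m * 'I_m])
        preimage_set_system [set: 'M[V]_m]
          (fun A : 'M[V]_m => A ij.1 ij.2) measurable >>.

Section independence.
Context {d} {T : measurableType d} {R : realType}.

(* The sets of G i are the events of the i-th component; for sigma-algebras
   this is mutual independence. *)
Definition independent_systems (P : probability T R) (I : finType)
    (G : I -> set_system T) : Prop :=
  forall (J : {set I}) (E : I -> set T), (forall i, i \in J -> G i (E i)) ->
    P (\bigcap_(i in [set` J]) E i) = (\prod_(i in J) P (E i))%E.

Definition independent_entries (P : probability T R) {dV}
    {V : measurableType dV} {m : nat} (X : T -> 'M[V]_m) : Prop :=
  independent_systems P (fun ij : 'I_m * 'I_m =>
    preimage_set_system setT (fun w => X w ij.1 ij.2) measurable).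

Definition independent_matrices (P : probability T R) {d1 d2}
    {V1 : measurableType d1} {V2 : measurableType d2} {m : nat}
    (X : T -> 'M[V1]_m) (Y : T -> 'M[V2]_m) : Prop :=
  independent_systems P (fun b : bool =>
    if b then preimage_set_system setT X mx_sigma
    else preimage_set_system setT Y mx_sigma).

End independence.

Section bernoulli_model.
Context {R : realType}.

Definition noise_assumption {d} {T : measurableType d} (P : probability T R)
    {m : nat} (U sigma : R) (eps : T -> 'M[R]_m) : Prop :=
  [/\ (forall i j, measurable_fun setT (fun w => eps w i j)),
      independent_entries P eps,
      (forall i j, 'E_P[fun w => eps w i j] = 0)%E,
      (forall i j, 'E_P[fun w => (eps w i j ^+ 2)%R] = (sigma ^+ 2)%:E)%E &
      {ae P, forall w, forall i j, `|eps w i j| <= U}].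

Definition bernoulli_mask {d} {T : measurableType d} (P : probability T R)
    {m : nat} (p : R) (B : T -> 'M[bool]_m) : Prop :=
  [/\ (forall i j, measurable_fun setT (fun w => B w i j)),
      independent_entries P B &
      forall i j, pushforward P (fun w => B w i j) =
                  bernoulli_prob p :> (set bool -> \bar R)].

Definition bernoulli_model {d} {T : measurableType d} (P : probability T R)
    (n m : nat) (U sigma : R) (B : T -> 'M[bool]_m) (eps : T -> 'M[R]_m) :
    Prop :=
  [/\ bernoulli_mask P (n%:R / m%:R ^+ 2) B,
      noise_assumption P U sigma eps &
      independent_matrices P B eps].

(* Entry (i, j) is the pair (Y_ij, B_ij), with Y_ij = B_ij (M_ij + eps_ij). *)
Definition data {m : nat} (M : 'M[R]_m) (B : 'M[bool]_m) (eps : 'M[R]_m) :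
    'M[R * bool]_m :=
  \matrix_(i, j) ((B i j)%:R * (M i j + eps i j), B i j).

(* The supremum ranges over the parameters (M, sigma) in A and over all noise
   laws allowed by the noise assumption; the latter are represented by all
   probability spaces carrying the model. *)
Definition sup_expectation (n m : nat) (U : R) (A : set ('M[R]_m * R))
    (phi : 'M[R * bool]_m -> R) : \bar R :=
  ereal_sup [set e : \bar R | exists f : 'M[R]_m * R, A f /\
    exists (d : measure_display) (T : measurableType d) (P : probability T R)
           (B : T -> 'M[bool]_m) (eps : T -> 'M[R]_m),
      bernoulli_model P n U f.2 B eps /\
      (e = 'E_P[fun w => phi (data f.1 (B w) (eps w))])%E].

Definition is_test {m : nat} (Psi : 'M[R * bool]_m -> bool) : Prop :=
  mx_sigma [set x | Psi x].

Definition testing_risk (n m : nat) (U : R) (A0 A1 : set ('M[R]_m * R))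
    (Psi : 'M[R * bool]_m -> bool) : \bar R :=
  (sup_expectation n U A0 (fun x => (Psi x)%:R%R) +
   sup_expectation n U A1 (fun x => (1 - (Psi x)%:R)%R))%E.

Definition null_hypothesis (m : nat) (a : R) (k0 : nat) : set ('M[R]_m * R) :=
  [set f | bounded_low_rank a k0 f.1 /\ f.2 = 1].

Definition alternative_hypothesis (m : nat) (a : R) (k0 k : nat) (rho : R) :
    set ('M[R]_m * R) :=
  [set f | [/\ bounded_low_rank a k f.1,
               m%:R ^+ 2 * rho ^+ 2 <=
                 dist_to frobenius_dist f.1 (bounded_low_rank a k0) ^+ 2 &
               f.2 = Num.sqrt (1 - 4 * rho ^+ 2)]].

Definition param_dist {m : nat} (f g : 'M[R]_m * R) : R :=
  frobenius_dist f.1 g.1.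

Definition testing_lower_bound (U : R) (F : set_system (nat * nat))
    (A A0 : forall nm : nat * nat, set ('M[R]_nm.2 * R))
    (rho_star : nat * nat -> R) (beta0 : R) : Prop :=
  0 < beta0 /\
  (beta0%:E <= limf_einf (fun nm : nat * nat => ereal_inf
    [set testing_risk nm.1 U (A0 nm)
       [set f | A nm f /\ (rho_star nm <= dist_to param_dist f (A0 nm))%R] Psi
    | Psi in is_test]) F)%E.

End bernoulli_model.

Arguments null_hypothesis {R} m a k0 _.
Arguments alternative_hypothesis {R} m a k0 k rho _.

(* Main.v *)
Require Import Defs.
From HB Require Import structures.
From mathcomp Require Import all_boot all_order all_algebra.
From mathcomp Require Import all_classical all_reals all_analysis.
From mathcomp Require Import ring lra zify.

Set Implicit Arguments.
Unset Strict Implicit.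
Unset Printing Implicit Defensive.

Import Order.TTheory GRing.Theory Num.Theory.
Import numFieldNormedType.Exports.

Local Open Scope classical_set_scope.
Local Open Scope ring_scope.

(** A mixture of matrices M of rank at most k that lie far from rank k0 is shown
    to be statistically indistinguishable from M = 0. Under the null the noise
    takes two values at each entry; tilting its law by the factor 1 + y M, where
    y is the value taken, gives a law of mean M on the same two values. For
    values 1 and - 1 the tilted law has variance 1 - M ^ 2, that is
    1 - 4 rho ^ 2 when M has entries 2 rho and - 2 rho, so that neither the
    support nor the second moments of the data betray the alternative. The
    likelihood ratios of M and M' have inner product prod_ij (1 + p M_ij M'_ij)
    under the null, p being the sampling rate, hence any test has risk at
    least 1 - e as soon as the average of this product over independent draws
    M, M' from the prior is at most 1 + e ^ 2 (testing_risk_second_moment).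

    The prior is M = 2 rho S with S_ij = r_(i, g(j)) w_j: all the r and w are
    independent random signs, and g assigns the columns to k groups, so S has
    rank at most k. The entries of S are uncorrelated in pairs; information is
    carried by cycles of four entries in two columns of one group. If the groups
    were known, these cycles would be detected too early. They are therefore
    random, but kept balanced: inside each block of k consecutive columns g is a
    cyclic shift by a random amount. Two independent copies split the columns
    into k ^ 2 cells on which both group maps are constant, and only a pair of
    columns in the same cell contributes. With x = 4 p rho ^ 2, the rows are
    independent, and for each row the average over r and r' is about
    exp (x ^ 2 (|D| ^ 2 - m) / 2), where D is the k by k matrix of the sums of
    w_j w'_j over the cells (row_overlap, quadratic_chaos_expR). The average of
    |D| ^ 2 over w is m, with fluctuations governed by the squared cell sizes
    (cell_sum_squares_expR), and the random shifts make most cells of size about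
    m / k ^ 2 (shift_count_expR). The leading terms cancel and what remains is
    exp (O (kappa)) with kappa = x ^ 2 m ^ 2 / k (mean_overlap_le), which is
    16 (rho ^ 2 n / (sqrt k m)) ^ 2 and tends to 0.

    For the distance, projecting on the complement of the row space of a matrix
    A of rank at most k0 gives |S - A| ^ 2 >= m ^ 2 - sqrt k0 |S S^T|
    (low_rank_distance). Since |S S^T| ^ 2 is of order m ^ 4 / k on average
    and k0 = o(k), Markov's inequality shows that most S satisfy
    |S - A| ^ 2 >= m ^ 2 / 4 for all such A (spread_fraction). Conditioning the
    prior on these S costs a factor that tends to 1 (unknown_variance_risk).

    In the second part the threshold rho is not multiplied by m, and sigma = 1 is
    available in Sigma. A single matrix (2 rho / m) S is then far enough, and with
    two noise values chosen so that the tilted law keeps variance 1 the second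
    moment is at most exp (4 rho ^ 2), while rho tends to 0
    (known_variance_risk). *)

(** * Exponential inequalities *)

Section exp.
Context {R : realType}.
Implicit Types x y : R.

Lemma fact_double_ge n : (2 ^ n * n`! <= (n.*2)`!)%N.
Proof.
elim: n => // n IHn.
rewrite doubleS !factS expnS.
have -> : (2 * 2 ^ n * (n.+1 * n`!) = n.*2.+2 * (2 ^ n * n`!))%N.
  by rewrite -doubleS -muln2; ring.
rewrite leq_mul // (leq_trans IHn) //.
by rewrite leq_pmull.
Qed.

(** The power series are compared term by term, as 2 ^ n n! <= (2 n)!. *)
Lemma cosh_le_expR y : (expR y + expR (- y)) / 2 <= expR (y ^+ 2 / 2).
Proof.
have cvgE (z : R) : series (exp_coeff z) @ \oo --> expR z.
  by rewrite /expR; exact: is_cvg_series_exp_coeff.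
pose S n := (series (exp_coeff y) n + series (exp_coeff (- y)) n) / 2.
have cS : S n @[n --> \oo] --> (expR y + expR (- y)) / 2.
  by apply: cvgMl; apply: cvgD; exact: cvgE.
have c2 : (S \o double) n @[n --> \oo] --> (expR y + expR (- y)) / 2.
  apply: cvg_comp cS.
  move=> A [N _ HN]; exists N => //= n Nn; apply: HN => /=.
  by rewrite (leq_trans Nn)// -addnn leq_addr.
apply: (ler_cvg_to c2 (cvgE (y ^+ 2 / 2))).
near=> n.
rewrite /= /S /series /=.
elim: (n) => [|k IHk]; first by rewrite /= !big_geq// addr0 mul0r.
rewrite doubleS !big_nat_recr//=.
rewrite [leLHS](_ : _ = (\sum_(0 <= i < k.*2) exp_coeff y i +
   \sum_(0 <= i < k.*2) exp_coeff (- y) i) / 2 + y ^+ k.*2 / (k.*2)`!%:R).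
  apply: lerD IHk _.
  rewrite /exp_coeff /= expr_div_n -exprM -muln2 mulnC.
  have f0 j : 0 < (j`!)%:R :> R by rewrite ltr0n fact_gt0.
  rewrite -mulrA ler_wpM2l//; first by rewrite mulnC exprM exprn_even_ge0// oddM andbF.
  rewrite -invfM lef_pV2 ?posrE ?mulr_gt0//.
    by rewrite -natrX -natrM ler_nat mul2n fact_double_ge.
rewrite /exp_coeff /=.
have -> : (- y) ^+ k.*2 = y ^+ k.*2 by rewrite exprNn -signr_odd odd_double mul1r.
have -> : (- y) ^+ k.*2.+1 = - y ^+ k.*2.+1.
  by rewrite exprNn -signr_odd /= odd_double mulN1r.
by field; rewrite !pnatr_eq0 -!lt0n !fact_gt0.
Unshelve. all: by end_near.
Qed.

(** From exp (- y) >= 1 - y; the constant 2 is what this crude bound allows. *)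
Lemma expR_quadratic_le y : y <= 1 / 2 -> expR y <= 1 + y + 2 * y ^+ 2.
Proof.
move=> y2.
have h : 0 < 1 - y by lra.
have e1 : 1 - y <= (expR y)^-1 by rewrite -expRN; exact: expR_ge1Dx.
have : expR y <= (1 - y)^-1 by rewrite -[leLHS]invrK lef_pV2// posrE ?invr_gt0 ?expR_gt0.
move=> /le_trans; apply.
rewrite -[leLHS]mul1r ler_pdivrMr//.
have := sqr_ge0 y.
nra.
Qed.

(** The term - x ^ 2 / 2 cancels the mean of the squared overlaps later, hence has
    to be exact. With theta = - ln (1 - x) - x ^ 2 / 2 the case of the sign - 1 is an
    equality and the other one reduces to 1 - x ^ 2 <= exp (- x ^ 2). *)
Lemma linear_le_expR x : 0 <= x < 1 -> exists theta : R,
  [/\ 0 <= theta, theta <= x / (1 - x) &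
   forall b : bool, 1 + x * (-1) ^+ b <= expR (theta * (-1) ^+ b - x ^+ 2 / 2)].
Proof.
move=> /andP[x0 x1].
have x1' : 0 < 1 - x by lra.
exists (- ln (1 - x) - x ^+ 2 / 2); split.
- have : ln (1 + - x) <= - x by apply: le_ln1Dx; lra.
  nra.
- have : ln (1 + (x / (1 - x))) <= x / (1 - x).
    by apply: le_ln1Dx; apply: lt_le_trans (divr_ge0 x0 (ltW x1')); lra.
  have -> : 1 + x / (1 - x) = (1 - x)^-1 by field; lra.
  rewrite lnV ?posrE// => h.
  have := sqr_ge0 x; lra.
- case=> /=.
  + rewrite expr1 mulrN1 [X in expR X](_ : _ = ln (1 - x)); last by ring.
    by rewrite lnK// posrE; lra.
  + rewrite expr0 !mulr1 [X in expR X](_ : _ = - ln (1 - x) - x ^+ 2); last by field.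
    rewrite expRD expRN lnK ?posrE//.
    rewrite mulrC ler_pdivlMr//.
    rewrite (_ : _ * _ = 1 + (- x ^+ 2)); last by ring.
    exact: expR_ge1Dx.
Qed.

End exp.

(** * Averages over finite types and random signs *)

Section mean.
Context {R : realType}.

Definition mean {T : finType} (f : T -> R) : R := (\sum_x f x) / #|T|%:R.

Section theory.
Context {T : finType}.
Implicit Types f g : T -> R.

Lemma eq_mean f g : f =1 g -> mean f = mean g.
Proof. by move=> fg; rewrite /mean (eq_bigr g). Qed.

Lemma ler_mean f g : (forall x, f x <= g x) -> mean f <= mean g.
Proof.
by move=> fg; rewrite /mean ler_wpM2r ?invr_ge0 ?ler0n// ler_sum.
Qed.

Lemma mean_ge0 f : (forall x, 0 <= f x) -> 0 <= mean f.
Proof. by move=> f0; rewrite divr_ge0 ?ler0n ?sumr_ge0. Qed.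

Lemma meanD f g : mean (fun x => f x + g x) = mean f + mean g.
Proof. by rewrite /mean big_split mulrDl. Qed.

Lemma meanZl c f : mean (fun x => c * f x) = c * mean f.
Proof. by rewrite /mean -mulr_sumr mulrA. Qed.

Lemma mean_sum (I : finType) (P : pred I) (F : I -> T -> R) :
  mean (fun x => \sum_(i | P i) F i x) = \sum_(i | P i) mean (F i).
Proof. by rewrite /mean exchange_big mulr_suml. Qed.

Lemma mean_cst c : (0 < #|T|)%N -> mean (fun _ : T => c) = c.
Proof.
move=> T0; rewrite /mean sumr_const -[c *+ _]mulr_natr mulfK//.
by rewrite pnatr_eq0 -lt0n.
Qed.

Lemma mean_bij f (h : T -> T) : bijective h -> mean (f \o h) = mean f.
Proof.
by move=> hb; rewrite /mean [in RHS](reindex h)//; exact: onW_bij.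
Qed.

(** Cancellation under a sign-reversing involution; with the flip of one sign it
    computes the moments of random signs. *)
Lemma mean_antisym f (h : T -> T) :
  involutive h -> (forall x, f (h x) = - f x) -> mean f = 0.
Proof.
move=> /inv_bij hb fN; apply/eqP; rewrite -eqNr; apply/eqP.
by rewrite -[RHS](mean_bij f hb) -mulN1r -meanZl; apply: eq_mean => x /=; rewrite fN mulN1r.
Qed.

Lemma mean_le_max f c : (0 < #|T|)%N -> (forall x, f x <= c) -> mean f <= c.
Proof. by move=> T0 fc; rewrite -[leRHS]mean_cst//; exact: ler_mean. Qed.

(** Jensen's inequality, from the tangent line at the mean. *)
Lemma expR_mean f : (0 < #|T|)%N -> expR (mean f) <= mean (expR \o f).
Proof.
move=> T0; set c := mean f.
have h x : expR c * (1 + (f x - c)) <= expR (f x).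
  rewrite [in leRHS](_ : f x = c + (f x - c)); last by ring.
  by rewrite expRD ler_wpM2l ?expR_ge0 ?expR_ge1Dx.
apply: le_trans (ler_mean h); rewrite meanZl !meanD !mean_cst// -/c.
by rewrite subrr addr0 mulr1.
Qed.

End theory.

Lemma mean_pair (S T : finType) (f : S * T -> R) :
  mean f = mean (fun x => mean (fun y => f (x, y))).
Proof.
rewrite /mean card_prod natrM invfM mulrA -mulr_suml.
by rewrite pair_big/= mulrAC; congr (_ / _ / _); apply: eq_bigr => -[].
Qed.

Lemma exchange_mean (S T : finType) (f : S -> T -> R) :
  mean (fun x => mean (f x)) = mean (fun y => mean (f ^~ y)).
Proof.
by rewrite /mean -!mulr_suml exchange_big mulrAC.
Qed.

Lemma mean_prod (I X : finType) (F : I -> X -> R) :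
  mean (fun w : {ffun I -> X} => \prod_i F i (w i)) = \prod_i mean (F i).
Proof.
rewrite /mean -bigA_distr_bigA big_split /= prodr_const card_ffun.
by rewrite natrX exprVn.
Qed.

Lemma mean_bool (f : bool -> R) : mean f = (f true + f false) / 2.
Proof. by rewrite /mean big_bool card_bool. Qed.

End mean.

Section signs.
Context {R : realType} {I : finType}.
Implicit Types (w : {ffun I -> bool}) (f : {ffun I -> bool} -> R).

Local Notation sg b := ((-1) ^+ b : R).

Definition flip (i : I) w : {ffun I -> bool} := [ffun j => (j == i) (+) w j].

Lemma flipK i : involutive (flip i).
Proof. by move=> w; apply/ffunP => j; rewrite !ffunE addKb. Qed.

Lemma flip_sign i w j : sg (flip i w j) = (-1) ^+ (j == i) * sg (w j).
Proof. by rewrite ffunE signr_addb. Qed.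

(** Averaging over one sign while the others are kept. *)
Lemma mean_flip i f : mean f = mean (fun w => (f w + f (flip i w)) / 2).
Proof.
under [RHS]eq_mean do rewrite mulrC.
rewrite meanZl meanD (mean_bij f (inv_bij (flipK i))).
by field.
Qed.

Lemma mean_sign2 i j : i != j -> mean (fun w => sg (w i) * sg (w j)) = 0.
Proof.
move=> ij; apply: (mean_antisym (flipK i)) => w.
by rewrite !flip_sign eqxx eq_sym (negbTE ij) mul1r expr1 mulN1r mulNr.
Qed.

(** If some index occurs only once, flipping its sign reverses the product;
    otherwise the two pairs agree up to order and the product is 1. *)
Lemma mean_sign4 (p q : I * I) : p.1 != p.2 -> q.1 != q.2 ->
  mean (fun w => sg (w p.1) * sg (w p.2) * (sg (w q.1) * sg (w q.2))) =
  ((q == p) || (q == (p.2, p.1)))%:R.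
Proof.
case: p q => [g h] [g' h'] /= gh gh'.
have card0 : (0 < #|{ffun I -> bool}|)%N.
  by rewrite card_ffun expn_gt0 card_bool.
have [eg|ng] := boolP (g \in [:: g'; h']); last first.
  rewrite (mean_antisym (flipK g)).
    rewrite !xpair_eqE.
    move: ng; rewrite !inE negb_or ![g == _]eq_sym => /andP[/negbTE-> /negbTE->].
    by rewrite andbF.
  move=> w; rewrite !flip_sign eqxx [h == g]eq_sym (negbTE gh).
  move: ng; rewrite !inE negb_or ![g == _]eq_sym => /andP[/negbTE-> /negbTE->].
  by rewrite !mul1r expr1 mulN1r !mulNr.
have [eh|nh] := boolP (h \in [:: g'; h']); last first.
  rewrite (mean_antisym (flipK h)).
    rewrite !xpair_eqE.
    move: nh; rewrite !inE negb_or ![h == _]eq_sym => /andP[/negbTE-> /negbTE->].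
    by rewrite andbF.
  move=> w; rewrite !flip_sign eqxx (negbTE gh).
  move: nh; rewrite !inE negb_or ![h == _]eq_sym => /andP[/negbTE-> /negbTE->].
  by rewrite !mul1r expr1 mulN1r mulrN !mulNr.
have -> : ((g', h') == (g, h)) || ((g', h') == (h, g)).
  move: eg eh; rewrite !inE => /orP[] /eqP e1 /orP[] /eqP e2.
  - by move: gh; rewrite e1 e2 eqxx.
  - by rewrite e1 e2 eqxx.
  - by rewrite e1 e2 eqxx orbT.
  - by move: gh; rewrite e1 e2 eqxx.
rewrite -[RHS](mean_cst 1 card0); apply: eq_mean => w.
have s1 b : sg b * sg b = 1 by rewrite -expr2 sqrr_sign.
move: eg eh; rewrite !inE => /orP[] /eqP e1 /orP[] /eqP e2.
- by move: gh; rewrite e1 e2 eqxx.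
- by rewrite e1 e2 mulrACA !s1 mulr1.
- by rewrite e1 e2 [sg (w h') * _]mulrC mulrACA !s1 mulr1.
- by move: gh; rewrite e1 e2 eqxx.
Qed.

End signs.

(** * Second-order Rademacher chaos *)

Section cauchy_schwarz.
Context {R : realType}.

Lemma cauchy_schwarz (I : finType) (a b : I -> R) :
  (\sum_i a i * b i) ^+ 2 <= (\sum_i a i ^+ 2) * (\sum_i b i ^+ 2).
Proof.
have : 0 <= \sum_i \sum_j (a i * b j - a j * b i) ^+ 2.
  by apply: sumr_ge0 => i _; apply: sumr_ge0 => j _; exact: sqr_ge0.
suff -> : \sum_i \sum_j (a i * b j - a j * b i) ^+ 2 =
    (\sum_i a i ^+ 2) * (\sum_i b i ^+ 2) + (\sum_i b i ^+ 2) * (\sum_i a i ^+ 2)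
    - 2 * ((\sum_i a i * b i) * (\sum_i a i * b i)) by lra.
rewrite !big_distrlr /= mulr_sumr -big_split -sumrB; apply: eq_bigr => i _.
rewrite mulr_sumr -big_split -sumrB; apply: eq_bigr => j _ /=; ring.
Qed.

Lemma weighted_cauchy_schwarz (I : finType) (w x : I -> R) :
  (\sum_i w i * x i) ^+ 2 <= (\sum_i `|w i|) * (\sum_i `|w i| * x i ^+ 2).
Proof.
have h : `|\sum_i w i * x i| <= \sum_i Num.sqrt `|w i| * (Num.sqrt `|w i| * `|x i|).
  rewrite (le_trans (ler_norm_sum _ _ _))// ler_sum// => i _.
  by rewrite mulrA -expr2 sqr_sqrtr// normrM.
apply: le_trans (_ : (\sum_i Num.sqrt `|w i| * (Num.sqrt `|w i| * `|x i|)) ^+ 2 <= _).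
  rewrite -[leLHS]real_normK ?num_real// ler_sqr ?nnegrE ?normr_ge0//.
  exact: le_trans h.
apply: le_trans (cauchy_schwarz _ _) _.
rewrite le_eqVlt; apply/orP; left; apply/eqP.
congr (_ * _); apply: eq_bigr => i _; first by rewrite sqr_sqrtr.
by rewrite exprMn sqr_sqrtr// real_normK ?num_real.
Qed.

(** The Schur test: bounds on the absolute row and column sums bound the operator
    norm. *)
Lemma schur_test (I J : finType) (A : I -> J -> R) (L : R) (v : I -> R) :
  (forall j, \sum_i `|A i j| <= L) -> (forall i, \sum_j `|A i j| <= L) ->
  \sum_j (\sum_i v i * A i j) ^+ 2 <= L ^+ 2 * \sum_i v i ^+ 2.
Proof.
move=> colL rowL.
have h j : (\sum_i v i * A i j) ^+ 2 <= L * \sum_i `|A i j| * v i ^+ 2.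
  under eq_bigr do rewrite mulrC.
  apply: le_trans (weighted_cauchy_schwarz _ _) _.
  by rewrite ler_wpM2r// sumr_ge0// => i _; rewrite mulr_ge0 ?sqr_ge0.
apply: le_trans (ler_sum _ (fun j _ => h j)) _.
rewrite -mulr_sumr exchange_big mulr_sumr mulr_sumr; apply: ler_sum => i _ /=.
have L0 : 0 <= L by apply: le_trans (rowL i); apply: sumr_ge0.
by rewrite -mulr_suml expr2 -mulrA ler_wpM2l// ler_wpM2r ?sqr_ge0.
Qed.

End cauchy_schwarz.

Section chaos.
Context {R : realType}.
Local Notation sg b := ((-1) ^+ b : R).

Lemma chaos_second_moment (K : finType) (G : K -> K -> R) :
  (forall g h, G g h = G h g) ->
  mean (fun r : {ffun K -> bool} =>
    (\sum_(p : K * K | p.1 != p.2) sg (r p.1) * sg (r p.2) * G p.1 p.2) ^+ 2)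
  <= 2 * \sum_g \sum_h G g h ^+ 2.
Proof.
move=> Gsym.
have -> : mean (fun r : {ffun K -> bool} =>
    (\sum_(p : K * K | p.1 != p.2) sg (r p.1) * sg (r p.2) * G p.1 p.2) ^+ 2) =
    \sum_(p : K * K | p.1 != p.2) \sum_(q : K * K | q.1 != q.2)
      G p.1 p.2 * G q.1 q.2 * ((q == p) || (q == (p.2, p.1)))%:R.
  under eq_mean do rewrite expr2 big_distrlr /=.
  rewrite mean_sum; apply: eq_bigr => p p12.
  rewrite mean_sum; apply: eq_bigr => q q12.
  rewrite -mean_sign4// -meanZl; apply: eq_mean => r; ring.
have -> : \sum_g \sum_h G g h ^+ 2 = \sum_(p : K * K) G p.1 p.2 ^+ 2.
  by rewrite pair_big.
rewrite mulr_sumr big_mkcond; apply: ler_sum => p _.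
case: ifPn => p12; last by rewrite mulr_ge0 ?sqr_ge0.
have -> : \sum_(q : K * K | q.1 != q.2) G p.1 p.2 * G q.1 q.2 *
      ((q == p) || (q == (p.2, p.1)))%:R = 
   \sum_(q : K * K) (if q == p then G p.1 p.2 ^+ 2 else 0) + 
   \sum_(q : K * K) (if q == (p.2, p.1) then G p.1 p.2 ^+ 2 else 0).
  rewrite -big_split big_mkcond; apply: eq_bigr => -[g h] _ /=.
  have [E|_] := eqVneq (g, h) p.
    subst p; move: p12 => /= p12.
    by rewrite p12 xpair_eqE (negbTE p12) mulr1 addr0 expr2.
  have [[-> ->]|_] := eqVneq (g, h) (p.2, p.1).
    by rewrite eq_sym p12 mulr1 add0r Gsym expr2.
  by rewrite mulr0 addr0 if_same.
by rewrite -!big_mkcond !big_pred1_eq; lra.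
Qed.

(** The quadratic form is its mean plus an off-diagonal chaos, and by the Schur
    test t times the form is at most 1 / 2. The exponential of the chaos can then be
    expanded to second order: the first moment vanishes and the second is at most
    twice the squared norm of D D^T, which the Schur test bounds by L ^ 2 |D| ^ 2. The
    leading coefficient t is exact, as needed for the final cancellation. *)
Lemma quadratic_chaos_expR (K H : finType) (D : K -> H -> R) (L t : R) :
  0 <= t -> (forall h, \sum_g `|D g h| <= L) -> (forall g, \sum_h `|D g h| <= L) ->
  t * L ^+ 2 * #|K|%:R <= 1 / 2 ->
  mean (fun r : {ffun K -> bool} =>
    expR (t * \sum_h (\sum_g sg (r g) * D g h) ^+ 2)) <=
  expR ((t + 4 * t ^+ 2 * L ^+ 2) * \sum_g \sum_h D g h ^+ 2).
Proof.
move=> t0 colL rowL tLK.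
set Q := \sum_g \sum_h D g h ^+ 2.
pose G g g' := \sum_h D g h * D g' h.
pose O (r : {ffun K -> bool}) :=
  \sum_(p : K * K | p.1 != p.2) sg (r p.1) * sg (r p.2) * G p.1 p.2.
have card0 : (0 < #|{ffun K -> bool}|)%N by rewrite card_ffun card_bool expn_gt0.
have Q0 : 0 <= Q by apply: sumr_ge0 => g _; apply: sumr_ge0 => h _; exact: sqr_ge0.
have YE (r : {ffun K -> bool}) : \sum_h (\sum_g sg (r g) * D g h) ^+ 2 = Q + O r.
  transitivity (\sum_(p : K * K) sg (r p.1) * sg (r p.2) * G p.1 p.2).
    under eq_bigr do rewrite expr2 big_distrlr /=.
    rewrite exchange_big -(pair_bigA _ (fun g g' => sg (r g) * sg (r g') * G g g'))/=.
    apply: eq_bigr => g _; rewrite exchange_big; apply: eq_bigr => g' _ /=.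
    by rewrite mulr_sumr; apply: eq_bigr => h _; ring.
  rewrite (bigID (fun p : K * K => p.1 == p.2)) /=; congr (_ + _).
  rewrite -(pair_big_dep xpredT (fun g g' => g == g')
    (fun g g' => sg (r g) * sg (r g') * G g g')) /=.
  apply: eq_bigr => g _; rewrite (big_pred1 g)//.
  by rewrite -expr2 sqrr_sign mul1r; apply: eq_bigr => h _; rewrite expr2.
have YL r : t * (Q + O r) <= 1 / 2.
  apply: le_trans tLK; rewrite -YE -mulrA ler_wpM2l//.
  apply: le_trans (schur_test _ colL rowL) _.
  rewrite ler_wpM2l ?sqr_ge0//.
  under eq_bigr do rewrite sqrr_sign.
  by rewrite sumr_const.
have tO r : t * O r <= 1 / 2 by have := YL r; have := mulr_ge0 t0 Q0; lra.
have G2 : \sum_g \sum_h G g h ^+ 2 <= L ^+ 2 * Q.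
  rewrite /Q mulr_sumr; apply: ler_sum => g _.
  by apply: schur_test => // h.
have O1 : mean O = 0.
  rewrite /O mean_sum big1// => p p12.
  under eq_mean do rewrite mulrC.
  by rewrite meanZl mean_sign2// mulr0.
have O2 : mean (fun r => O r ^+ 2) <= 2 * (L ^+ 2 * Q).
  apply: le_trans (chaos_second_moment _) _; last by rewrite ler_pM2l.
  by move=> g h; apply: eq_bigr => i _; rewrite mulrC.
apply: le_trans (_ : mean (fun r => expR (t * Q) * (1 + t * O r + 2 * t ^+ 2 * O r ^+ 2)) <= _).
  apply: ler_mean => r; rewrite YE mulrDr expRD ler_wpM2l ?expR_ge0//.
  apply: le_trans (expR_quadratic_le (tO r)) _.
  by rewrite le_eqVlt; apply/orP; left; apply/eqP; ring.
rewrite meanZl 2!meanD mean_cst// !meanZl O1 mulr0 addr0.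
rewrite [X in _ <= expR X]mulrDl expRD ler_wpM2l ?expR_ge0//.
apply: le_trans (expR_ge1Dx _).
by have := ler_wpM2l (sqr_ge0 t) O2; lra.
Qed.

End chaos.

(** * Squared sums of signs over the cells of a partition *)

Section cells.
Context {R : realType} {I C : finType}.
Variables (c : I -> C) (eps : I -> R).
Hypothesis eps2 : forall i, eps i ^+ 2 = 1.
Local Notation sg b := ((-1) ^+ b : R).

Let N (A : {set I}) (d : C) : R := \sum_(i in A | c i == d) 1.
Let X (A : {set I}) (d : C) (w : {ffun I -> bool}) : R :=
  \sum_(i in A | c i == d) sg (w i) * eps i.

Let N_ge0 A d : 0 <= N A d. Proof. by apply: sumr_ge0. Qed.

(* The weight l of a cell with n + 1 hidden signs becomes l + 2 l ^ 2 when one of them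
   is revealed; this is the inductive step for the bound l n + 4 l ^ 2 n ^ 2. *)
Let weight_step (l n : R) : 0 <= l -> 0 <= n -> l * (1 + n) <= 1 / 10 ->
  (l + 2 * l ^+ 2) * n <= 1 / 10 /\
  l + ((l + 2 * l ^+ 2) * n + 4 * (l + 2 * l ^+ 2) ^+ 2 * n ^+ 2) <=
  l * (1 + n) + 4 * l ^+ 2 * (1 + n) ^+ 2.
Proof.
move=> l0 n0 ln.
have ln0 : 0 <= l * n by apply: mulr_ge0.
have l1 : l <= 1 / 10 by lra.
have p1 : l * (l * n) <= l * (1 / 10) by apply: ler_wpM2l => //; lra.
have q1 := sqr_ge0 l.
have q2 : 0 <= l ^+ 2 * n by rewrite mulr_ge0 ?sqr_ge0.
split; first by lra.
have p2 : 4 * (l + 2 * l ^+ 2) ^+ 2 * n ^+ 2 <=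
    4 * l ^+ 2 * n ^+ 2 + 4 * l ^+ 2 * (5 * (l * n)) * n.
  have -> : 4 * (l + 2 * l ^+ 2) ^+ 2 * n ^+ 2 =
    4 * l ^+ 2 * n ^+ 2 + 4 * l ^+ 2 * ((4 + 4 * l) * (l * n)) * n by ring.
  rewrite lerD2l ler_wpM2r// ler_wpM2l ?mulr_ge0 ?sqr_ge0//.
  by rewrite ler_wpM2r//; lra.
have p3 : 4 * l ^+ 2 * (5 * (l * n)) * n <= 2 * l ^+ 2 * n.
  rewrite ler_wpM2r//.
  have : l ^+ 2 * (l * n) <= l ^+ 2 * (1 / 10) by rewrite ler_wpM2l ?sqr_ge0//; lra.
  lra.
lra.
Qed.

(* Averaging over the revealed sign s leaves a cosh of the cross term 2 l s x. *)
Let reveal_sign (rest l x s : R) : s ^+ 2 = 1 ->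
  (expR (rest + l * (s + x) ^+ 2) + expR (rest + l * (- s + x) ^+ 2)) / 2 <=
  expR l * expR (rest + (l + 2 * l ^+ 2) * x ^+ 2).
Proof.
move=> s2.
have -> : rest + l * (s + x) ^+ 2 = rest + l * x ^+ 2 + l * s ^+ 2 + (2 * l * s * x).
  by ring.
have -> : rest + l * (- s + x) ^+ 2 = rest + l * x ^+ 2 + l * s ^+ 2 + (- (2 * l * s * x)).
  by ring.
rewrite !(expRD (_ + l * s ^+ 2)) -mulrDr -mulrA.
apply: le_trans (ler_wpM2l (expR_ge0 _) (cosh_le_expR _)) _.
rewrite -!expRD ler_expR.
have -> : (2 * l * s * x) ^+ 2 / 2 = 2 * l ^+ 2 * x ^+ 2 * s ^+ 2 by field.
by rewrite s2; lra.
Qed.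

(** The signs are revealed one at a time. Weights that depend on the cell are
    needed since only the weight of the revealed cell increases. *)
Lemma cell_sum_squares_expR_on (A : {set I}) (l : C -> R) :
  (forall d, 0 <= l d) -> (forall d, l d * N A d <= 1 / 10) ->
  mean (fun w => expR (\sum_d l d * X A d w ^+ 2)) <=
  expR (\sum_d (l d * N A d + 4 * l d ^+ 2 * N A d ^+ 2)).
Proof.
elim: {A}#|A| {-2}A (erefl #|A|) l => [|n IHn] A cA l l0 lN.
  have -> : A = finset.set0 by apply/eqP; rewrite -cards_eq0 cA.
  apply: mean_le_max => [|w]; first by rewrite card_ffun card_bool expn_gt0.
  rewrite ler_expR; apply: ler_sum => d _.
  rewrite /X big_pred0 => [|i]; last by rewrite finset.in_set0.
  by rewrite expr0n mulr0 addr_ge0 ?mulr_ge0 ?sqr_ge0.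
have [i0 i0A] : exists i, i \in A by apply/card_gt0P; rewrite cA.
pose A' := (A :\ i0)%SET.
have cA' : #|A'| = n by move: (cardsD1 i0 A); rewrite i0A cA => -[].
pose c0 := c i0.
pose l' d := if d == c0 then l d + 2 * l d ^+ 2 else l d.
have splitA (F : I -> R) d : \sum_(i in A | c i == d) F i =
    (if d == c0 then F i0 else 0) + \sum_(i in A' | c i == d) F i.
  have [->|dc0] := eqVneq d c0.
    rewrite (bigD1 i0) ?i0A ?eqxx//=; congr (_ + _); apply: eq_bigl => i.
    by rewrite in_setD1; case: (i == i0); rewrite ?andbF ?andbT.
  rewrite add0r; apply: eq_bigl => i; rewrite in_setD1.
  have [->|//] := eqVneq i i0.
  by rewrite eq_sym (negbTE dc0) andbF.
have NE d : N A d = (if d == c0 then 1 else 0) + N A' d by exact: splitA.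
have XE d w : X A d w = (if d == c0 then sg (w i0) * eps i0 else 0) + X A' d w.
  exact: splitA.
have Xflip d w : X A' d (flip i0 w) = X A' d w.
  apply: eq_bigr => i /andP[]; rewrite in_setD1 => /andP[ii0 _] _.
  by rewrite flip_sign (negbTE ii0) mul1r.
have sumD (f : C -> R) : \sum_d f d = f c0 + \sum_(d | d != c0) f d.
  by rewrite (bigD1 c0).
rewrite (mean_flip i0).
apply: le_trans (_ : mean (fun w => expR (l c0) * expR (\sum_d l' d * X A' d w ^+ 2)) <= _).
  apply: ler_mean => w.
  rewrite !sumD ![_ * _ + _]addrC !XE !eqxx Xflip flip_sign eqxx expr1 mulN1r mulNr.
  have restE (v : {ffun I -> bool}) : (forall d, X A' d v = X A' d w) ->
      \sum_(i | i != c0) l i * X A i v ^+ 2 = \sum_(i | i != c0) l i * X A' i w ^+ 2.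
    by move=> h; apply: eq_bigr => d /negbTE dc0; rewrite XE dc0 add0r h.
  rewrite (restE w)// (restE (flip i0 w))//.
  apply: le_trans (reveal_sign _ _ _ _) _.
    by rewrite exprMn sqrr_sign eps2 mul1r.
  rewrite ler_wpM2l ?expR_ge0// ler_expR /l' eqxx lerD2r.
  by apply: ler_sum => d /negbTE ->.
have step d : 0 <= l' d /\ l' d * N A' d <= 1 / 10.
  rewrite /l'; have := lN d; rewrite NE; case: ifP => _.
    by move=> /(weight_step (l0 d) (N_ge0 A' d)) [? _]; rewrite addr_ge0 ?mulr_ge0 ?sqr_ge0.
  by rewrite add0r.
rewrite meanZl; apply: le_trans (ler_wpM2l (expR_ge0 _) (IHn A' cA' l' _ _)) _.
- by move=> d; case: (step d).
- by move=> d; case: (step d).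
rewrite -expRD ler_expR !sumD addrA lerD//.
  rewrite /l' NE eqxx.
  by apply: (weight_step _ _ _).2 => //; have := lN c0; rewrite NE eqxx.
by apply: ler_sum => d /negbTE dc0; rewrite /l' NE dc0 add0r.
Qed.

Lemma cell_sum_squares_expR (l : R) : 0 <= l ->
  (forall d, l * (\sum_(i | c i == d) 1) <= 1 / 10) ->
  mean (fun w : {ffun I -> bool} =>
    expR (l * \sum_d (\sum_(i | c i == d) sg (w i) * eps i) ^+ 2)) <=
  expR (l * #|I|%:R + 4 * l ^+ 2 * \sum_d (\sum_(i | c i == d) 1) ^+ 2).
Proof.
move=> l0 lN.
have T (F : I -> R) d : \sum_(i in [set: I]%SET | c i == d) F i = \sum_(i | c i == d) F i.
  by apply: eq_bigl => i; rewrite finset.in_setT.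
have := @cell_sum_squares_expR_on [set: I]%SET (fun=> l) (fun=> l0).
have NE : N [set: I]%SET = fun d => \sum_(i | c i == d) 1 by apply/funext => d; exact: T.
have XE d w : X [set: I]%SET d w = \sum_(i | c i == d) sg (w i) * eps i by exact: T.
rewrite NE => /(_ lN).
under eq_mean do under eq_bigr do rewrite XE.
under eq_mean do rewrite -mulr_sumr.
move=> /le_trans; apply.
rewrite ler_expR big_split -!mulr_sumr /=.
suff -> : \sum_d \sum_(i | c i == d) 1 = #|I|%:R :> R by [].
by rewrite -sum1_card natr_sum (partition_big c xpredT).
Qed.


End cells.

(** * Overlap of two sign matrices with given column groups *)

Section overlap.
Context {R : realType} {I J K : finType}.
Local Notation sg b := ((-1) ^+ b : R).
Implicit Types (g h : J -> K).

Definition group_size (g : J -> K) (d : K) : R := \sum_(j | g j == d) 1.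

(** Linearising the product, the average over r' is a product of cosh, hence at
    most the exponential of half the squared norm of theta D^T r, and the average
    over r is a quadratic chaos. Here D is the matrix of the sums of a over the
    cells, and L bounds its absolute row and column sums since it bounds the
    group sizes. *)
Lemma row_overlap (g h : J -> K) (a : J -> bool) (x theta L : R) :
  (forall b : bool, 1 + x * sg b <= expR (theta * sg b - x ^+ 2 / 2)) ->
  0 <= x <= 1 ->
  (forall d, group_size g d <= L) -> (forall d, group_size h d <= L) ->
  theta ^+ 2 / 2 * L ^+ 2 * #|K|%:R <= 1 / 2 ->
  mean (fun r : {ffun K -> bool} => mean (fun r' : {ffun K -> bool} =>
    \prod_j (1 + x * (sg (r (g j)) * sg (r' (h j)) * sg (a j))))) <=
  expR (- (x ^+ 2 / 2 * #|J|%:R) +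
    (theta ^+ 2 / 2 + 4 * (theta ^+ 2 / 2) ^+ 2 * L ^+ 2) *
    \sum_d (\sum_(j | (g j, h j) == d) sg (a j)) ^+ 2).
Proof.
move=> lin /andP[x0 x1] gL hL tLK.
pose D (u v : K) : R := \sum_(j | (g j, h j) == (u, v)) sg (a j).
have DL1 v : \sum_u `|D u v| <= L.
  apply: le_trans (hL v); rewrite /group_size (partition_big g xpredT)//=.
  apply: ler_sum => u _; apply: le_trans (ler_norm_sum _ _ _) _.
  rewrite (eq_bigr (fun=> 1)) => [|j _]; last by rewrite normr_sign.
  by rewrite le_eqVlt; apply/orP; left; apply/eqP; apply: eq_bigl => j; rewrite xpair_eqE andbC.
have DL2 u : \sum_v `|D u v| <= L.
  apply: le_trans (gL u); rewrite /group_size (partition_big h xpredT)//=.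
  apply: ler_sum => v _; apply: le_trans (ler_norm_sum _ _ _) _.
  rewrite (eq_bigr (fun=> 1)) => [|j _]; last by rewrite normr_sign.
  by rewrite le_eqVlt; apply/orP; left; apply/eqP; apply: eq_bigl => j; rewrite xpair_eqE.
have sgE (b : bool) : sg b = 1 \/ sg b = -1 by case: b; [right; exact: expr1|left; exact: expr0].
rewrite expRD.
apply: le_trans (_ : mean (fun r : {ffun K -> bool} => expR (- (x ^+ 2 / 2 * #|J|%:R)) *
   expR (theta ^+ 2 / 2 * \sum_v (\sum_u sg (r u) * D u v) ^+ 2)) <= _); last first.
  rewrite meanZl ler_wpM2l ?expR_ge0//.
  apply: le_trans (quadratic_chaos_expR _ DL1 DL2 tLK) _.
    by rewrite divr_ge0 ?sqr_ge0.
  rewrite ler_expR pair_bigA /=.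
  rewrite le_eqVlt; apply/orP; left; apply/eqP; congr (_ * _).

apply: ler_mean => r.
apply: le_trans (_ : mean (fun r' : {ffun K -> bool} => expR (- (x ^+ 2 / 2 * #|J|%:R)) *
   \prod_v expR (theta * (sg (r' v) * \sum_u sg (r u) * D u v))) <= _).
  apply: ler_mean => r'.
  apply: le_trans (_ : \prod_j expR
    (theta * (sg (r (g j)) * sg (r' (h j)) * sg (a j)) - x ^+ 2 / 2) <= _).
    apply: ler_prod => j _; rewrite -!signr_addb lin andbT.
    by have [->|->] := sgE (r (g j) (+) r' (h j) (+) a j); lra.
  rewrite -!expR_sum -expRD ler_expR big_split /= addrC sumr_const -[X in X + _ <= _]mulr_natr mulNr.
  rewrite lerD2l -!mulr_sumr.
  rewrite le_eqVlt; apply/orP; left; apply/eqP; congr (_ * _).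
  rewrite (partition_big h xpredT)//=; apply: eq_bigr => v _.
  rewrite (partition_big g xpredT)//= mulr_sumr; apply: eq_bigr => u _.
  rewrite /D !mulr_sumr; apply: eq_big => [j|j /andP[/eqP-> /eqP->]].
    by rewrite xpair_eqE andbC.
  by ring.
rewrite meanZl ler_wpM2l ?expR_ge0//.
rewrite (mean_prod (fun v (b : bool) => expR (theta * (sg b * \sum_u sg (r u) * D u v)))).
rewrite mulr_sumr expR_sum; apply: ler_prod => v _.
rewrite mean_ge0 => [|b]; last exact: expR_ge0.
rewrite mean_bool /= expr1 expr0 mul1r mulN1r mulrN addrC.
apply: le_trans (cosh_le_expR _) _.
by rewrite exprMn mulrAC.
Qed.

(** The rows are independent, so the bound for one row is raised to the power
    #|I|; the squared norm of D is then averaged over the column signs w. *)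
Lemma overlap_given_groups (g h : J -> K) (w' : {ffun J -> bool}) (x theta L lam : R) :
  (forall b : bool, 1 + x * sg b <= expR (theta * sg b - x ^+ 2 / 2)) ->
  0 <= x <= 1 ->
  (forall d, group_size g d <= L) -> (forall d, group_size h d <= L) ->
  theta ^+ 2 / 2 * L ^+ 2 * #|K|%:R <= 1 / 2 ->
  lam = (theta ^+ 2 / 2 + 4 * (theta ^+ 2 / 2) ^+ 2 * L ^+ 2) * #|I|%:R ->
  lam * L <= 1 / 10 ->
  mean (fun w : {ffun J -> bool} =>
    mean (fun r : {ffun I -> {ffun K -> bool}} => mean (fun r' : {ffun I -> {ffun K -> bool}} =>
      \prod_i \prod_j (1 + x * ((sg (r i (g j)) * sg (w j)) * (sg (r' i (h j)) * sg (w' j))))))) <=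
  expR (- (x ^+ 2 / 2 * #|J|%:R * #|I|%:R) + lam * #|J|%:R + 4 * lam ^+ 2 *
    \sum_d (\sum_(j | (g j, h j) == d) 1) ^+ 2).
Proof.
move=> lin x01 gL hL tLK lamE lamL.
have lam0 : 0 <= lam.
  have t0 : 0 <= theta ^+ 2 / 2 by rewrite divr_ge0 ?sqr_ge0.
  rewrite lamE mulr_ge0 ?ler0n// addr_ge0// (mulr_ge0 _ (sqr_ge0 L))//.
  by rewrite (mulr_ge0 _ (sqr_ge0 _)).
rewrite -addrA expRD.
apply: le_trans (_ : mean (fun w : {ffun J -> bool} => expR (- (x ^+ 2 / 2 * #|J|%:R * #|I|%:R)) *
   expR (lam * \sum_d (\sum_(j | (g j, h j) == d) sg (w j) * sg (w' j)) ^+ 2)) <= _); last first.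
  rewrite meanZl ler_wpM2l ?expR_ge0//.
  apply: (cell_sum_squares_expR (c := fun j => (g j, h j)) (eps := fun j => sg (w' j))) => //.
    by move=> j; rewrite sqrr_sign.
  move=> -[u v]; apply: le_trans lamL; rewrite ler_wpM2l//; apply: le_trans (gL u).
  rewrite /group_size big_mkcond [leRHS]big_mkcond; apply: ler_sum => j _.
  by rewrite xpair_eqE; case: (g j == u) => //=; case: ifP.
apply: ler_mean => w.
have -> : mean (fun r : {ffun I -> {ffun K -> bool}} => mean (fun r' : {ffun I -> {ffun K -> bool}} =>
      \prod_i \prod_j (1 + x * ((sg (r i (g j)) * sg (w j)) * (sg (r' i (h j)) * sg (w' j)))))) =
   \prod_(i : I) mean (fun r : {ffun K -> bool} => mean (fun r' : {ffun K -> bool} =>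
    \prod_j (1 + x * (sg (r (g j)) * sg (r' (h j)) * sg (w j (+) w' j))))).
  rewrite -(mean_prod (fun _ (r : {ffun K -> bool}) => mean (fun r' : {ffun K -> bool} =>
    \prod_j (1 + x * (sg (r (g j)) * sg (r' (h j)) * sg (w j (+) w' j)))))).
  apply: eq_mean => r.
  rewrite -(mean_prod (fun i (r' : {ffun K -> bool}) =>
    \prod_j (1 + x * (sg (r i (g j)) * sg (r' (h j)) * sg (w j (+) w' j))))).
  apply: eq_mean => r'; apply: eq_bigr => i _; apply: eq_bigr => j _.
  by rewrite signr_addb mulrACA.
rewrite prodr_const -expRD.
set q := mean _.
have q0 : 0 <= q.
  apply: mean_ge0 => r; apply: mean_ge0 => r'; apply: prodr_ge0 => j _.
  rewrite -!signr_addb; set b := _ (+) _.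
  by case: b => /=; rewrite ?expr1 ?expr0; move/andP: x01 => [? ?]; lra.
have := row_overlap (fun j => w j (+) w' j) lin x01 gL hL tLK; rewrite -/q => qle.
apply: le_trans (lerXn2r #|I| _ _ qle) _; rewrite ?nnegrE ?expR_ge0//.
rewrite -expRM_natr ler_expR mulrDl.
rewrite lamE.
have -> : \sum_d (\sum_(j | (g j, h j) == d) sg (w j) * sg (w' j)) ^+ 2 =
    \sum_d (\sum_(j | (g j, h j) == d) sg (w j (+) w' j)) ^+ 2.
  by apply: eq_bigr => d _; congr (_ ^+ 2); apply: eq_bigr => j _; rewrite signr_addb.
lra.
Qed.

End overlap.

(** * Random column groups *)

Section design.
Context {R : realType} {m k' : nat}.
Local Notation k := k'.+1.
Local Notation b := (m %/ k).+1.
Local Notation sg b := ((-1) ^+ b : R).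

Definition column_block (j : 'I_m) : 'I_b := inord (j %/ k).

(** Inside a block of k consecutive columns this is a cyclic shift of the position
    in the block: a group contains at most one column of each block, whatever the
    shifts are. *)
Definition column_group (s : {ffun 'I_b -> 'I_k}) (j : 'I_m) : 'I_k :=
  (inZp j + s (column_block j))%R.

Lemma column_block_group_inj s (i j : 'I_m) :
  column_block i = column_block j -> column_group s i = column_group s j -> i = j.
Proof.
move=> bij; rewrite /column_group bij => /addIr /(congr1 val) /= eqm.
have blt (l : 'I_m) : (l %/ k < b)%N by rewrite ltnS leq_div2r// ltnW.
move: bij => /(congr1 val); rewrite /= !inordK// => eqd.
by apply/val_inj; rewrite /= (divn_eq i k) (divn_eq j k) eqm eqd.
Qed.

Lemma block_group_le1 s d t :
  \sum_(j | (column_group s j == d) && (column_block j == t)) 1 <= 1 :> R.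
Proof.
have [j0 /andP[/eqP gj /eqP bj]|none] :=
  pickP (fun j => (column_group s j == d) && (column_block j == t)).
  rewrite (big_pred1 j0)// => j.
  apply/andP/eqP => [[/eqP g /eqP e]|->]; last by rewrite gj bj.
  by apply: (@column_block_group_inj s); rewrite ?gj ?bj.
by rewrite big_pred0.
Qed.

Lemma column_group_size_le s d : group_size (column_group s) d <= b%:R :> R.
Proof.
rewrite /group_size (partition_big column_block xpredT)//=.
apply: le_trans (ler_sum _ (fun t _ => block_group_le1 s d t)) _.
by rewrite sumr_const card_ord.
Qed.

Definition shift_count (s s' : {ffun 'I_b -> 'I_k}) (d : 'I_k) : R :=
  \sum_(t | s' t - s t == d) 1.

(** In a block that meets the cell (u, v) the two shifts differ by v - u, and such a
    block meets it in one column. *)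
Lemma cell_size_le s s' (u v : 'I_k) :
  \sum_(j | (column_group s j, column_group s' j) == (u, v)) 1 <= shift_count s s' (v - u).
Proof.
rewrite (partition_big column_block xpredT)//= /shift_count [leRHS]big_mkcond.
apply: ler_sum => t _; case: ifPn => [_|nt].
  apply: le_trans (block_group_le1 s u t).
  rewrite big_mkcond [leRHS]big_mkcond; apply: ler_sum => j _.
  by rewrite xpair_eqE; case: (column_group s j == u); case: (column_block j == t);
    rewrite ?andbF//=; case: ifP.
rewrite big_pred0// => j; apply/negbTE; apply: contra nt => /andP[/eqP[<- <-] /eqP <-].
by rewrite /column_group opprD addrACA subrr add0r.
Qed.

Lemma sum_cell_size_sq_le s s' :
  \sum_d (\sum_(j | (column_group s j, column_group s' j) == d) 1) ^+ 2 <=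
  \sum_j shift_count s s' (s' (column_block j) - s (column_block j)).
Proof.
rewrite [leRHS](partition_big (fun j => (column_group s j, column_group s' j)) xpredT)//=.
apply: ler_sum => -[u v] _; rewrite expr2 mulr_suml; apply: ler_sum => j /eqP [<- <-].
rewrite mul1r; apply: le_trans (cell_size_le _ _ _ _) _.
by rewrite /column_group opprD addrACA subrr add0r.
Qed.

(** Subtracting the shift of the block t0 from the other shifts is a bijection,
    and makes the count a sum of independent indicators. *)
Lemma shift_count_expR (s' : {ffun 'I_b -> 'I_k}) (t0 : 'I_b) (eta : R) :
  0 <= eta ->
  mean (fun s => expR (eta * shift_count s s' (s' t0 - s t0))) <=
  expR eta * (1 + (expR eta - 1) / k%:R) ^+ (m %/ k).
Proof.
move=> eta0.
pose h (s : {ffun 'I_b -> 'I_k}) : {ffun 'I_b -> 'I_k} :=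
  [ffun t => if t == t0 then s t0 else s t - s t0].
have hbij : bijective h.
  exists (fun s : {ffun 'I_b -> 'I_k} => [ffun t => if t == t0 then s t0 else s t + s t0]) => s;
    apply/ffunP => t; rewrite !ffunE eqxx; case: eqP => [->//|_].
  - by rewrite subrK.
  - by rewrite addrK.
pose F (t : 'I_b) (x : 'I_k) : R :=
  if t == t0 then expR eta else if x == s' t - s' t0 then expR eta else 1.
have FE s : expR (eta * shift_count s s' (s' t0 - s t0)) = \prod_t F t (h s t).
  rewrite /shift_count big_mkcond mulr_sumr expR_sum; apply: eq_bigr => t _.
  rewrite /F !ffunE; have [->|_] := eqVneq t t0; first by rewrite eqxx mulr1.
  have -> : (s t - s t0 == s' t - s' t0) = (s' t - s t == s' t0 - s t0).
    rewrite -subr_eq0 opprB [RHS]eq_sym -[RHS]subr_eq0 opprB.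
    by rewrite addrACA [in RHS]addrACA [s t + _]addrC.
  by case: ifP => _; rewrite ?mulr1 ?mulr0 ?expR0.
under eq_mean do rewrite FE.
rewrite (mean_bij (fun s : {ffun 'I_b -> 'I_k} => \prod_t F t (s t)) hbij) mean_prod.
rewrite (bigD1 t0)//= {1}/F eqxx mean_cst ?card_ord// ler_wpM2l ?expR_ge0//.
have e1 t : t != t0 -> mean (F t) = 1 + (expR eta - 1) / k%:R.
  move=> /negbTE tt0; rewrite /F tt0.
  transitivity (mean (fun x : 'I_k => 1 + (if x == s' t - s' t0 then expR eta - 1 else 0))).
    by apply: eq_mean => x; case: ifP => _; rewrite ?addr0// addrC subrK.
  rewrite meanD mean_cst ?card_ord//; congr (_ + _).
  by rewrite /mean -big_mkcond big_pred1_eq card_ord.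
rewrite (eq_bigr _ e1) prodr_const.
suff -> : #|[pred t | t != t0]| = (m %/ k)%N by [].
by rewrite (@eq_card _ _ (predC1 t0))// cardC1 card_ord.
Qed.

End design.

(** * Constants of the overlap bound *)

Section arith.
Context {R : realType}.

(** The error terms of overlap_given_groups for group sizes at most L <= 2 m / k:
    x k is at most 1 / 10, so theta ^ 2 = x ^ 2 (1 + O (x)), and
    theta ^ 2 L ^ 2 = O (kappa / k); multiplied by x ^ 2 m ^ 2 <= kappa k both
    relative errors leave at most a multiple of kappa. *)
Lemma overlap_constants (m k L x kappa theta lam : R) :
  0 <= x -> 1 <= k -> k ^+ 2 <= m -> 0 <= L -> k * L <= 2 * m ->
  x ^+ 2 * m ^+ 2 <= kappa * k -> kappa <= 1 / 200 ->
  0 <= theta -> theta * (1 - x) <= x ->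
  lam = (theta ^+ 2 / 2 + 4 * (theta ^+ 2 / 2) ^+ 2 * L ^+ 2) * m ->
  [/\ x <= 1 / 10, theta ^+ 2 / 2 * L ^+ 2 * k <= 1 / 2, lam * L <= 1 / 10,
      - (x ^+ 2 / 2 * m * m) + lam * m <= kappa &
      4 * lam ^+ 2 * m * m <= 4 * kappa ^+ 2 * k ^+ 2].
Proof.
move=> x0 k1 km L0 kL xm kap th0 thx lamE.
have k0 : 0 < k by lra.
have m0 : 0 < m by apply: lt_le_trans km; apply: exprn_gt0.
have kap0 : 0 <= kappa.
  rewrite -(pmulr_lge0 _ k0); apply: le_trans xm.
  by apply: mulr_ge0; apply: sqr_ge0.
have xk2 : (x * k) ^+ 2 <= 1 / 200.
  have h1 : x ^+ 2 * (k ^+ 2) ^+ 2 <= kappa * k.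
    apply: le_trans xm; rewrite ler_wpM2l ?sqr_ge0// ler_sqr ?nnegrE ?sqr_ge0//.
    exact: ltW.
  have h2 : (x * k) ^+ 2 * k <= kappa.
    rewrite -(ler_pM2r k0); apply: le_trans h1.
    by rewrite le_eqVlt; apply/orP; left; apply/eqP; ring.
  apply: le_trans kap; apply: le_trans h2; rewrite ler_peMr ?sqr_ge0//.
have xk : x * k <= 1 / 10.
  rewrite -[leRHS]ger0_norm; last by lra.
  rewrite -[leLHS]ger0_norm; last by rewrite mulr_ge0// ltW.
  rewrite -ler_sqr ?nnegrE// real_normK ?num_real// real_normK ?num_real//.
  by apply: le_trans xk2 _; lra.
have x1 : x <= 1 / 10 by apply: le_trans xk; rewrite ler_peMr.
set t := theta ^+ 2 / 2 in lamE *.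
have t0 : 0 <= t by rewrite /t divr_ge0 ?sqr_ge0.
have x20 := sqr_ge0 x.
have th2 : theta ^+ 2 <= x ^+ 2 * (1 + 3 * x).
  have h : theta ^+ 2 * (1 - x) ^+ 2 <= x ^+ 2.
    rewrite -exprMn ler_sqr ?nnegrE//; apply: mulr_ge0 => //; lra.
  have x10 : 0 <= 1 - x by lra.
  have p : 1 <= (1 + 3 * x) * (1 - x) ^+ 2.
    have -> : (1 + 3 * x) * (1 - x) ^+ 2 = 1 + x * (1 - 5 * x) + 3 * x ^+ 2 * x by ring.
    have : 0 <= x * (1 - 5 * x) by apply: mulr_ge0 => //; lra.
    have : 0 <= 3 * x ^+ 2 * x by apply: mulr_ge0 => //; lra.
    lra.
  apply: (le_trans (_ : _ <= theta ^+ 2 * ((1 + 3 * x) * (1 - x) ^+ 2))).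
    by rewrite ler_peMr ?sqr_ge0.
  have -> : theta ^+ 2 * ((1 + 3 * x) * (1 - x) ^+ 2) =
     theta ^+ 2 * (1 - x) ^+ 2 * (1 + 3 * x) by ring.
  by rewrite ler_wpM2r//; lra.
have x2x : x ^+ 2 * x <= x ^+ 2 * (1 / 10) by rewrite ler_wpM2l.
have tx : t <= x ^+ 2 * (65 / 100) by rewrite /t; lra.
have tLk : t * L ^+ 2 * k <= 4 * kappa.
  rewrite -(ler_pM2r k0).
  have -> : t * L ^+ 2 * k * k = t * (k * L) ^+ 2 by ring.
  apply: (le_trans (_ : _ <= x ^+ 2 * (2 * m) ^+ 2)).
    apply: ler_pM => //; first exact: sqr_ge0; first by lra.
    by rewrite ler_sqr ?nnegrE ?mulr_ge0//; lra.
  have -> : x ^+ 2 * (2 * m) ^+ 2 = 4 * (x ^+ 2 * m ^+ 2) by ring.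
  lra.
pose e := 4 * (t * L ^+ 2).
have e0 : 0 <= e by rewrite /e !mulr_ge0// sqr_ge0.
have ek : e * k <= 16 * kappa by rewrite /e; lra.
have e1 : e <= 8 / 100.
  by apply: (le_trans (_ : _ <= e * k)); [rewrite ler_peMr|lra].
have lamE' : lam = t * (1 + e) * m by rewrite lamE /e; ring.
have te : t * (1 + e) <= x ^+ 2.
  have : t * e <= t * (8 / 100) by rewrite ler_wpM2l.
  lra.
have lam0 : 0 <= lam by rewrite lamE' mulr_ge0 ?(ltW m0)// mulr_ge0//; lra.
have lamx : lam <= x ^+ 2 * m by rewrite lamE' ler_wpM2r// ltW.
split => //.
- by apply: le_trans tLk _; lra.
- apply: (le_trans (_ : _ <= 2 * kappa)); last lra.
  rewrite -(ler_pM2r k0) -mulrA [L * k]mulrC.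
  apply: (le_trans (_ : _ <= x ^+ 2 * m * (2 * m))).
    by apply: ler_pM => //; rewrite mulr_ge0// ltW.
  have -> : x ^+ 2 * m * (2 * m) = 2 * (x ^+ 2 * m ^+ 2) by ring.
  lra.
- have h1 : t * (1 + e) - x ^+ 2 / 2 <= x ^+ 2 / 2 * (3 * x + 2 * e).
    have : t * (1 + e) <= x ^+ 2 * (1 + 3 * x) / 2 * (1 + e).
      by rewrite ler_wpM2r ?addr_ge0//; rewrite /t; lra.
    have : x ^+ 2 * (x * e) <= x ^+ 2 * (1 / 10 * e).
      by rewrite ler_wpM2l// ler_wpM2r.
    have : 0 <= x ^+ 2 * e by apply: mulr_ge0.
    lra.
  have -> : - (x ^+ 2 / 2 * m * m) + lam * m = m ^+ 2 * (t * (1 + e) - x ^+ 2 / 2).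
    by rewrite lamE'; ring.
  apply: le_trans (ler_wpM2l (sqr_ge0 _) h1) _.
  have -> : m ^+ 2 * (x ^+ 2 / 2 * (3 * x + 2 * e)) =
            x ^+ 2 * m ^+ 2 * (3 * x / 2 + e) by field.
  apply: (le_trans (_ : _ <= kappa * k * (3 * x / 2 + e))).
    by rewrite ler_wpM2r//; lra.
  have -> : kappa * k * (3 * x / 2 + e) = kappa * (3 / 2 * (x * k) + e * k) by field.
  by rewrite -[leRHS]mulr1 ler_wpM2l//; lra.
- have -> : 4 * lam ^+ 2 * m * m = 4 * (lam * m) ^+ 2 by ring.
  have -> : 4 * kappa ^+ 2 * k ^+ 2 = 4 * (kappa * k) ^+ 2 by ring.
  have lm : lam * m <= kappa * k.
    by apply: le_trans xm; rewrite [m ^+ 2]expr2 mulrA ler_wpM2r// ltW.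
  have lm0 : 0 <= lam * m by rewrite mulr_ge0// ltW.
  rewrite ler_wpM2l// ler_sqr// nnegrE//; exact: le_trans lm.
Qed.

End arith.

(** * The prior on sign matrices and its overlap *)

Section prior.
Context {R : realType} (m k' : nat).
Local Notation k := k'.+1.
Local Notation b := (m %/ k).+1.
Local Notation sg b := ((-1) ^+ b : R).

(** The shifts of the blocks, the signs of the columns, and for each row the signs
    of its k groups. *)
Definition prior_index : finType :=
  ({ffun 'I_b -> 'I_k} * ({ffun 'I_m -> bool} * {ffun 'I_m -> {ffun 'I_k -> bool}}))%type.

Definition sign_matrix (o : prior_index) : 'M[R]_m :=
  \matrix_(i, j) (sg (o.2.2 i (column_group o.1 j)) * sg (o.2.1 j)).

Lemma prior_index_gt0 : (0 < #|prior_index|)%N.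
Proof.
apply/card_gt0P.
by exists ([ffun=> ord0], ([ffun=> true], [ffun=> [ffun=> true]])).
Qed.

Lemma block_number_bound : (k <= m)%N -> (k * b <= 2 * m)%N.
Proof.
move=> km; rewrite mulnS mul2n -addnn leq_add//.
by rewrite mulnC leq_trunc_div.
Qed.

(** The sum of the squared cell sizes is at most a sum over the columns of shift
    counts. By Jensen's inequality its exponential is at most an average over the
    columns, and each term is the exponential moment of one shift count. *)
Lemma mean_overlap_le (x kappa : R) : 0 <= x -> (k ^ 2 <= m)%N ->
  x ^+ 2 * m%:R ^+ 2 <= kappa * k%:R -> kappa <= 1 / 200 ->
  mean (fun o => mean (fun o' =>
    \prod_i \prod_j (1 + x * (sign_matrix o i j * sign_matrix o' i j)))) <=
  expR (2 * kappa).
Proof.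
move=> x0 km xm kap.
have k1 : 1 <= k%:R :> R by rewrite ler1n.
have k0 : 0 < k%:R :> R by rewrite ltr0n.
have kmR : k%:R ^+ 2 <= m%:R :> R by rewrite -natrX ler_nat.
have kleqm : (k <= m)%N by apply: leq_trans km; rewrite expnS expn1 leq_pmulr.
have m0 : 0 < m%:R :> R by rewrite ltr0n (leq_trans _ kleqm).
have bR : k%:R * b%:R <= 2 * m%:R :> R.
  by rewrite -!natrM ler_nat block_number_bound.
have kap0 : 0 <= kappa.
  rewrite -(pmulr_lge0 _ k0); apply: le_trans xm.
  by apply: mulr_ge0; apply: sqr_ge0.
have x1 : 0 <= x < 1.
  rewrite x0 /=.
  have h : x ^+ 2 * m%:R ^+ 2 <= kappa * m%:R ^+ 2.
    apply: (le_trans xm); rewrite ler_wpM2l//.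
    rewrite (le_trans (_ : _ <= m%:R))// ?ler_nat// expr2 ler_peMr ?ler0n// ler1n.
    by move: m0; rewrite ltr0n.
  have : x ^+ 2 <= kappa by move: h; rewrite ler_pM2r// exprn_gt0.
  by move=> h'; rewrite -(@ltr_sqr R)  ?nnegrE//; lra.
have [theta [th0 thx lin]] := linear_le_expR x1.
have x1' : 0 < 1 - x by move: x1 => /andP[_]; rewrite subr_gt0.
rewrite ler_pdivlMr// in thx.
pose lam : R := (theta ^+ 2 / 2 + 4 * (theta ^+ 2 / 2) ^+ 2 * b%:R ^+ 2) * m%:R.
have [x110 tL lamL expo eta2] :=
  overlap_constants x0 k1 kmR (ler0n R b) bR xm kap th0 thx (erefl lam).
pose eta := 4 * lam ^+ 2 * m%:R.
have lam40 : 0 <= 4 * lam ^+ 2 by apply: mulr_ge0 => //; exact: sqr_ge0.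
have eta0 : 0 <= eta by rewrite /eta mulr_ge0 ?ler0n.
have eta4 : eta <= 4 * kappa ^+ 2.
  rewrite -(ler_pM2r m0); apply: le_trans eta2 _.
  by rewrite ler_wpM2l// mulr_ge0 ?sqr_ge0.
have kap2 : kappa ^+ 2 <= kappa * (1 / 200) by rewrite expr2 ler_wpM2l.
pose c := expR (- (x ^+ 2 / 2 * m%:R * m%:R) + lam * m%:R).
have shiftB (s' : {ffun 'I_b -> 'I_k}) :
  mean (fun s : {ffun 'I_b -> 'I_k} => expR (4 * lam ^+ 2 *
    \sum_d (\sum_(j | (column_group s j, column_group s' j) == d) 1) ^+ 2)) <= expR kappa.
  apply: le_trans (_ : mean (fun s : {ffun 'I_b -> 'I_k} => mean (fun j : 'I_m =>
      expR (eta * shift_count s s' (s' (column_block j) - s (column_block j))))) <= _).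
    apply: ler_mean => s; apply: le_trans (expR_mean _ _); last first.
      by rewrite card_ord -(@ltr0n R).
    rewrite ler_expR meanZl /eta -[leRHS]mulrA ler_wpM2l//.
    rewrite /mean card_ord mulrC divfK ?gt_eqF//.
    exact: sum_cell_size_sq_le.
  rewrite exchange_mean; apply: mean_le_max => [|j].
    by rewrite card_ord -(@ltr0n R).
  apply: le_trans (shift_count_expR _ _ eta0) _.
  have eeta : expR eta - 1 <= 2 * eta.
    have eta12 : eta <= 1 / 2 by apply: (le_trans eta4); lra.
    have := expR_quadratic_le eta12; have : eta * eta <= eta * (1 / 2).
      by rewrite ler_wpM2l.
    by move: (eta) (expR eta) => y z; lra.
  apply: le_trans (_ : expR eta * expR (2 * eta / k%:R) ^+ (m %/ k) <= _).
    rewrite ler_wpM2l ?expR_ge0// lerXn2r ?nnegrE ?expR_ge0//.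
      by rewrite addr_ge0// divr_ge0// subr_ge0 -(@expR0 R) ler_expR.
    apply: le_trans (expR_ge1Dx _); rewrite lerD2l ler_wpM2r// invr_ge0.
  rewrite -expRM_natr -expRD ler_expR.
  have bk : (m %/ k)%:R * k%:R <= m%:R :> R by rewrite -natrM ler_nat leq_trunc_div.
  have h : 2 * eta / k%:R * (m %/ k)%:R <= 8 * kappa ^+ 2.
    rewrite -(ler_pM2r k0) -(ler_pM2r k0).
    have -> : 2 * eta / k%:R * (m %/ k)%:R * k%:R * k%:R =
      2 * eta * ((m %/ k)%:R * k%:R) by field; rewrite gt_eqF.
    apply: le_trans (_ : 2 * eta * m%:R <= _); first by rewrite ler_wpM2l// mulr_ge0.
    have -> : 8 * kappa ^+ 2 * k%:R * k%:R = 2 * (4 * kappa ^+ 2 * k%:R ^+ 2) by ring.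
    by rewrite -mulrA ler_wpM2l.
  by apply: (le_trans (lerD eta4 h)); lra.
(* The averages are reordered: those over both sets of row signs are taken first,
   then that over the column signs w, and that over the shifts s last, the second
   shifts s' and column signs w' staying fixed. *)
rewrite (_ : mean _ = mean (fun s' : {ffun 'I_b -> 'I_k} => mean (fun w' : {ffun 'I_m -> bool} =>
   mean (fun s : {ffun 'I_b -> 'I_k} => mean (fun w : {ffun 'I_m -> bool} =>
   mean (fun r : {ffun 'I_m -> {ffun 'I_k -> bool}} =>
   mean (fun r' : {ffun 'I_m -> {ffun 'I_k -> bool}} => \prod_i \prod_j (1 + x *
     ((sg (r i (column_group s j)) * sg (w j)) * (sg (r' i (column_group s' j)) * sg (w' j)))))))))));
  last first.
  under eq_mean do rewrite mean_pair.
  rewrite exchange_mean; apply: eq_mean => s'.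
  under eq_mean do rewrite mean_pair.
  rewrite exchange_mean; apply: eq_mean => w'.
  rewrite mean_pair; apply: eq_mean => s.
  rewrite mean_pair; apply: eq_mean => w; apply: eq_mean => r; apply: eq_mean => r'.
  by apply: eq_bigr => i _; apply: eq_bigr => j _; rewrite !mxE.
apply: mean_le_max => [|s']; first by rewrite card_ffun expn_gt0 card_ord.
apply: mean_le_max => [|w']; first by rewrite card_ffun expn_gt0 card_bool.
apply: le_trans (_ : mean (fun s : {ffun 'I_b -> 'I_k} => c * expR (4 * lam ^+ 2 *
    \sum_d (\sum_(j | (column_group s j, column_group s' j) == d) 1) ^+ 2)) <= _).
  apply: ler_mean => s; rewrite /c -expRD.
  have x01 : 0 <= x <= 1 by rewrite x0; lra.
  have := @overlap_given_groups R 'I_m 'I_m 'I_k (column_group s) (column_group s')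
   w' x theta b%:R lam lin x01
   (column_group_size_le s) (column_group_size_le s').
  rewrite !card_ord => /(_ tL erefl lamL).
  exact.
rewrite meanZl; apply: le_trans (_ : expR kappa * expR kappa <= _).
  apply: ler_pM => //; first exact: expR_ge0; last by rewrite ler_expR.
  by apply: mean_ge0 => s; exact: expR_ge0.
by rewrite -expRD mulr_natl mulr2n.
Qed.

End prior.

(** * Gram energy of the sign matrices *)

Section gram_energy.
Context {R : realType} (m k' : nat).
Local Notation k := k'.+1.
Local Notation b := (m %/ k).+1.
Local Notation sg b := ((-1) ^+ b : R).

(** The fourth power of the Schatten 4-norm: few large singular values make it
    large. *)
Definition gram_energy {p q} (M : 'M[R]_(p, q)) : R :=
  \sum_i \sum_j (M *m M^T) i j ^+ 2.

(** Flipping the sign of row i and group g j shows that the pairs of columns in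
    different groups cancel on average. *)
Lemma mean_gram_offdiag (g : 'I_m -> 'I_k) (w : {ffun 'I_m -> bool}) (i i' : 'I_m) :
  i != i' -> (forall d, group_size g d <= b%:R :> R) ->
  mean (fun r : {ffun 'I_m -> {ffun 'I_k -> bool}} =>
    (\sum_j (sg (r i (g j)) * sg (w j)) * (sg (r i' (g j)) * sg (w j))) ^+ 2) <=
  m%:R * b%:R.
Proof.
move=> ii' gb.
have card0 : (0 < #|{ffun 'I_m -> {ffun 'I_k -> bool}}|)%N.
  by apply/card_gt0P; exists [ffun=> [ffun=> true]].
under eq_mean do rewrite expr2 big_distrlr /=.
rewrite mean_sum.
have -> : m%:R * b%:R = \sum_(j < m) b%:R :> R.
  by rewrite sumr_const card_ord mulr_natl.
apply: ler_sum => j _; rewrite mean_sum; apply: le_trans (gb (g j)).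
rewrite /group_size [leRHS]big_mkcond; apply: ler_sum => j' _.
case: ifPn => [_|gjj].
  by apply: mean_le_max => // r; rewrite -!signr_addb; case: (_ (+) _);
    rewrite /= ?expr0 ?expr1// (le_trans _ ler01)// oppr_le0.
pose h (r : {ffun 'I_m -> {ffun 'I_k -> bool}}) : {ffun 'I_m -> {ffun 'I_k -> bool}} :=
  [ffun l => if l == i then flip (g j) (r l) else r l].
rewrite (mean_antisym (h := h))// => [r|r].
  by apply/ffunP => l; rewrite !ffunE; case: eqP => // _; rewrite flipK.
rewrite !ffunE eqxx [i' == i]eq_sym (negbTE ii') !flip_sign eqxx (negbTE gjj).
rewrite expr1 expr0; ring.
Qed.

Lemma mean_gram_energy_le :
  mean (fun o : prior_index m k' => gram_energy (sign_matrix (R := R) o)) <=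
  m%:R ^+ 3 * (1 + b%:R).
Proof.
have sq1 (c : bool) : sg c * sg c = 1 by rewrite -expr2 sqrr_sign.
rewrite mean_pair; apply: mean_le_max => [|s].
  by apply/card_gt0P; exists [ffun=> ord0].
rewrite mean_pair; apply: mean_le_max => [|w].
  by apply/card_gt0P; exists [ffun=> true].
have card0 : (0 < #|{ffun 'I_m -> {ffun 'I_k -> bool}}|)%N.
  by apply/card_gt0P; exists [ffun=> [ffun=> true]].
rewrite /gram_energy mean_sum.
have -> : m%:R ^+ 3 * (1 + b%:R) =
    \sum_(i < m) (m%:R ^+ 2 + m%:R * (m%:R * b%:R)) :> R.
  by rewrite sumr_const card_ord -[RHS]mulr_natl; ring.
apply: ler_sum => i _; rewrite mean_sum (bigD1 i)//= lerD//.
  apply: mean_le_max => // r; rewrite mxE.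
  under eq_bigr do rewrite !mxE /= mulrACA !sq1 mulr1.
  by rewrite sumr_const card_ord.
apply: (le_trans (_ : _ <= \sum_(i' < m | i' != i) m%:R * b%:R)).
  apply: ler_sum => i'; rewrite eq_sym => ii'.
  apply: le_trans (mean_gram_offdiag w ii' (column_group_size_le s)).
  by apply: ler_mean => r; rewrite mxE; under eq_bigr do rewrite !mxE.
rewrite big_mkcond; apply: (le_trans (_ : _ <= \sum_(i' < m) m%:R * b%:R)).
  by apply: ler_sum => i' _; case: ifP => // _; rewrite mulr_ge0.
by rewrite sumr_const card_ord -[leLHS]mulr_natl.
Qed.

End gram_energy.

(** * Distance to matrices of low rank *)

Section low_rank.
Context {R : realType}.

Definition sqnorm {p q} (M : 'M[R]_(p, q)) : R := \sum_i \sum_j M i j ^+ 2.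

Lemma sqnorm_trace p q (M : 'M[R]_(p, q)) : sqnorm M = \tr (M *m M^T).
Proof.
by apply: eq_bigr => i _; rewrite mxE; apply: eq_bigr => j _; rewrite mxE expr2.
Qed.

Lemma sqnorm_ge0 p q (M : 'M[R]_(p, q)) : 0 <= sqnorm M.
Proof. by apply: sumr_ge0 => i _; apply: sumr_ge0 => j _; exact: sqr_ge0. Qed.

Lemma sqnorm_eq0 p q (M : 'M[R]_(p, q)) : sqnorm M = 0 -> M = 0.
Proof.
move=> /eqP; rewrite psumr_eq0 => [|i _]; last first.
  by apply: sumr_ge0 => j _; exact: sqr_ge0.
move=> /allP h; apply/matrixP => i j; rewrite mxE.
have := h i (mem_index_enum _); rewrite /= psumr_eq0 => [|l _]; last exact: sqr_ge0.
by move=> /allP /(_ j (mem_index_enum _)) /=; rewrite sqrf_eq0 => /eqP.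
Qed.

Lemma sqnorm_tr p q (M : 'M[R]_(p, q)) : sqnorm M^T = sqnorm M.
Proof.
rewrite /sqnorm exchange_big; apply: eq_bigr => i _.
by apply: eq_bigr => j _; rewrite mxE.
Qed.

Lemma gram_unit p q (B : 'M[R]_(p, q)) : row_free B -> B *m B^T \in unitmx.
Proof.
move=> Bfree; rewrite -row_free_unit; apply: inj_row_free => v vG.
have : sqnorm (v *m B) = 0.
  by rewrite sqnorm_trace trmx_mul mulmxA -[v *m B *m _]mulmxA vG mul0mx mxtrace0.
move=> /sqnorm_eq0 vB; apply/eqP; rewrite -(mulmx_free_eq0 v Bfree); exact/eqP.
Qed.

(** The orthogonal projection B^T (B B^T)^-1 B for a basis B of the row space. *)
Lemma row_space_projection p q (A : 'M[R]_(p, q)) : exists Q : 'M[R]_q,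
  [/\ Q^T = Q, Q *m Q = Q, A *m Q = A & \tr Q = (\rank A)%:R].
Proof.
move: (row_base A) (row_base_free A) (eq_row_base A) => B Bfree eqB.
pose G := B *m B^T; have Gu : G \in unitmx by exact: gram_unit.
have GT : G^T = G by rewrite /G trmx_mul trmxK.
exists (B^T *m invmx G *m B); split.
- by rewrite !trmx_mul trmxK trmx_inv GT mulmxA.
- rewrite !mulmxA -[_ *m B *m B^T]mulmxA -/G.
  by rewrite -[_ *m G]mulmxA mulVmx// mulmx1.
- have /submxP[C AC] : (A <= B)%MS by rewrite eqB.
  transitivity (C *m B *m (B^T *m invmx G *m B)); first by rewrite -AC.
  rewrite !mulmxA -[C *m B *m B^T]mulmxA -/G -[_ *m invmx G]mulmxA mulmxV// mulmx1.
  exact: esym.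
- by rewrite mxtrace_mulC mulmxA mulmxV// mxtrace1.
Qed.

(** Projecting on the complement of the row space of A kills A and shrinks
    norms, and the part of M that is lost is controlled by the Cauchy-Schwarz
    inequality for the trace form. *)
Lemma low_rank_distance p q (M A : 'M[R]_(p, q)) (r : nat) (c : R) :
  (\rank A <= r)%N -> 0 <= c -> r%:R * sqnorm (M^T *m M) <= c ^+ 2 ->
  sqnorm M - c <= sqnorm (M - A).
Proof.
move=> Ar c0 rc.
have [Q [QT QQ AQ trQ]] := row_space_projection A.
have split n (N : 'M[R]_(n, q)) : sqnorm N = \tr (N *m Q *m N^T) + sqnorm (N - N *m Q).
  rewrite !sqnorm_trace linearB /= trmx_mul QT mulmxBr !mulmxBl.
  rewrite !mulmxA -[N *m Q *m Q]mulmxA QQ subrr subr0.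
  by rewrite -linearD /= addrC subrK.
have lost : \tr (M *m Q *m M^T) <= c.
  have -> : \tr (M *m Q *m M^T) = \sum_(ij : 'I_q * 'I_q) (Q ij.1 ij.2) * (M^T *m M) ij.1 ij.2.
    rewrite -mulmxA mxtrace_mulC -mulmxA /mxtrace.
    rewrite -(pair_bigA _ (fun i j => Q i j * (M^T *m M) i j)) /=.
    apply: eq_bigr => i _; rewrite mxE; apply: eq_bigr => j _; congr (_ * _).
    by rewrite -[in RHS](trmxK M) -trmx_mul trmxK [RHS]mxE.
  set T := \sum_ij _.
  have T2 : T ^+ 2 <= c ^+ 2.
    apply: (le_trans (cauchy_schwarz _ _)).
    rewrite -(pair_bigA _ (fun i j => Q i j ^+ 2)) /=.
    rewrite -(pair_bigA _ (fun i j => (M^T *m M) i j ^+ 2)) /=.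
    have -> : \sum_i \sum_j Q i j ^+ 2 = (\rank A)%:R.
      by rewrite -[LHS]/(sqnorm Q) sqnorm_trace QT QQ.
    by apply: le_trans rc; rewrite ler_wpM2r ?sqnorm_ge0// ler_nat.
  apply: le_trans (ler_norm T) _.
  rewrite -[leRHS]ger0_norm//.
  by rewrite -ler_sqr ?nnegrE// !real_normK ?num_real.
apply: (le_trans (_ : _ <= sqnorm (M - M *m Q))).
  by rewrite (split _ M) addrAC gerDr subr_le0.
have -> : M - M *m Q = (M - A) - (M - A) *m Q.
  by rewrite mulmxBl AQ opprB addrA subrK.
rewrite [leRHS]split lerDr.
have -> : \tr ((M - A) *m Q *m (M - A)^T) = sqnorm ((M - A) *m Q).
  by rewrite sqnorm_trace trmx_mul QT mulmxA -[_ *m Q *m Q]mulmxA QQ.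
exact: sqnorm_ge0.
Qed.

End low_rank.

(** * Probability spaces of coin tosses *)

Section finite_probability.
Context {I : finType}.

(** One boolean per entry for the mask and one for the noise. *)
Definition coins : Type := ({ffun I -> bool} * {ffun I -> bool})%type.

HB.instance Definition _ := Finite.on coins.
HB.instance Definition _ := isPointed.Build coins ([ffun=> true], [ffun=> true]).
HB.instance Definition _ := @isMeasurable.Build default_measure_display
  coins discrete_measurable discrete_measurable0
  discrete_measurableC discrete_measurableU.

Lemma coins_measurable_fun d (V : measurableType d) (f : coins -> V) (D : set coins) :
  measurable_fun D f.
Proof. by []. Qed.

End finite_probability.
Arguments coins : clear implicits.

Section coin_law.
Context {R : realType} {I : finType}.
Variables (w : coins I -> R) (w_ge0 : forall x, 0 <= w x) (w_sum1 : \sum_x w x = 1).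

(* An enumeration of the space: the law is a finite sum of Dirac masses. *)
Let atom (n : nat) : coins I := nth point (enum {: coins I}) n.

(** The proof that the weights sum to 1 is an argument, so that the probability
    structure can be inferred from the term. *)
Definition coin_law of \sum_x w x = 1 : set (coins I) -> \bar R :=
  msum (fun n => mscale (NngNum (w_ge0 (atom n))) \d_(atom n)) #|{: coins I}|.

Local Notation law := (coin_law w_sum1).

HB.instance Definition _ := Measure.on law.

Let sum_atom (V : nmodType) (f : coins I -> V) :
  \sum_(n < #|{: coins I}|) f (atom n) = \sum_x f x.
Proof.
rewrite -(big_mkord xpredT (fun n => f (atom n))) cardE -(big_nth _ xpredT).
by rewrite big_enum.
Qed.

Lemma coin_lawE A : law A = (\sum_x w x * (x \in A)%:R)%:E.
Proof.
rewrite /coin_law /msum /mscale /=.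
rewrite (sum_atom (fun x => (w x)%:E * \d_x A)%E).
rewrite -sumEFin; apply: eq_bigr => x _.
by rewrite diracE EFinM.
Qed.

Let coin_law_setT : law setT = 1%E.
Proof.
rewrite coin_lawE; congr (_%:E); rewrite -[RHS]w_sum1.
by apply: eq_bigr => x _; rewrite in_setT mulr1.
Qed.

HB.instance Definition _ :=
  @Measure_isProbability.Build _ _ R law coin_law_setT.

Let ge0_integral_coin_law (f : coins I -> R) : (forall x, 0 <= f x) ->
  (\int[law]_x (f x)%:E = (\sum_x w x * f x)%:E)%E.
Proof.
move=> f0; rewrite /coin_law ge0_integral_measure_sum//; last by move=> x _; rewrite lee_fin.
under eq_bigr => n _.
  rewrite ge0_integral_mscale//; last by move=> x _; rewrite lee_fin.
  rewrite integral_dirac// diracT mul1e /=; over.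
rewrite (sum_atom (fun x => (w x)%:E * (f x)%:E)%E) -sumEFin.
by apply: eq_bigr => x _; rewrite EFinM.
Qed.

Lemma expectation_coin_law (f : coins I -> R) :
  ('E_law[f] = (\sum_x w x * f x)%:E)%E.
Proof.
rewrite unlock integralE.
have -> : (fun x => (f x)%:E)^\+%E = (fun x => (Num.max (f x) 0)%:E) :> (coins I -> _).
  by apply/funext => x; rewrite funeposE EFin_max.
have -> : (fun x => (f x)%:E)^\-%E = (fun x => (Num.max (- f x) 0)%:E) :> (coins I -> _).
  by apply/funext => x; rewrite funenegE EFin_max.
rewrite !ge0_integral_coin_law => [|x|x]; last 2 first.
- by rewrite le_max lexx orbT.
- by rewrite le_max lexx orbT.
rewrite -EFinB -sumrB; congr (_%:E); apply: eq_bigr => x _; rewrite -mulrBr.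
congr (_ * _); case: (leP 0 (f x)) => h.
  by rewrite max_r ?oppr_le0// subr0.
by rewrite max_l ?oppr_ge0 ?ltW// sub0r opprK.
Qed.

End coin_law.

(** * Independent tosses *)

Section product_law.
Context {R : realType} {I : finType}.

Lemma sum_prod_factor (q : I -> bool -> R) (q1 : forall i, \sum_t q i t = 1)
    (J : {set I}) (f : I -> bool -> R) :
  \sum_(c : {ffun I -> bool}) (\prod_i q i (c i)) * \prod_(i in J) f i (c i) =
  \prod_(i in J) \sum_t q i t * f i t.
Proof.
pose F i t := q i t * (if i \in J then f i t else 1).
transitivity (\sum_(c : {ffun I -> bool}) \prod_i F i (c i)).
  apply: eq_bigr => c _; rewrite big_split /=; congr (_ * _).
  by rewrite big_mkcond.
rewrite -bigA_distr_bigA [RHS]big_mkcond; apply: eq_bigr => i _.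
rewrite /F; case: (i \in J) => //.
by under eq_bigr do rewrite mulr1; exact: q1.
Qed.

Lemma sum_prod1 (q : I -> bool -> R) (q1 : forall i, \sum_t q i t = 1) :
  \sum_(c : {ffun I -> bool}) (\prod_i q i (c i)) = 1.
Proof.
transitivity (\prod_i \sum_t q i t); last by rewrite big1.
by rewrite bigA_distr_bigA.
Qed.

Variables (p : R) (q : I -> bool -> R).
Hypotheses (p01 : 0 <= p <= 1) (q0 : forall i t, 0 <= q i t)
  (q1 : forall i, \sum_t q i t = 1).

Definition product_weight (x : coins I) : R :=
  (\prod_i bernoulli_pmf p (x.1 i)) * \prod_i q i (x.2 i).

Lemma product_weight_ge0 x : 0 <= product_weight x.
Proof.
by apply: mulr_ge0; apply: prodr_ge0 => i _ //; exact: bernoulli_pmf_ge0.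
Qed.

Lemma bernoulli_pmf_sum1 : \sum_t bernoulli_pmf p t = 1.
Proof. by rewrite big_bool /= addrC subrK. Qed.

Lemma sum_product_weight (u v : {ffun I -> bool} -> R) :
  \sum_x product_weight x * (u x.1 * v x.2) =
  (\sum_(b : {ffun I -> bool}) (\prod_i bernoulli_pmf p (b i)) * u b) *
  (\sum_(c : {ffun I -> bool}) (\prod_i q i (c i)) * v c).
Proof.
rewrite big_distrlr /= pair_bigA /=; apply: eq_bigr => x _.
by rewrite /product_weight; ring.
Qed.

Lemma sum_product_weight1 (u : {ffun I -> bool} -> R) :
  \sum_x product_weight x * u x.1 = \sum_(b : {ffun I -> bool}) (\prod_i bernoulli_pmf p (b i)) * u b.
Proof.
transitivity (\sum_x product_weight x * (u x.1 * 1)).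
  by apply: eq_bigr => x _; rewrite mulr1.
rewrite (sum_product_weight u (fun=> 1)) [X in _ * X](_ : _ = 1) ?mulr1//.
by under eq_bigr do rewrite mulr1; exact: sum_prod1.
Qed.

Lemma sum_product_weight2 (v : {ffun I -> bool} -> R) :
  \sum_x product_weight x * v x.2 = \sum_(c : {ffun I -> bool}) (\prod_i q i (c i)) * v c.
Proof.
transitivity (\sum_x product_weight x * (1 * v x.2)).
  by apply: eq_bigr => x _; rewrite mul1r.
rewrite (sum_product_weight (fun=> 1) v) [X in X * _](_ : _ = 1) ?mul1r//.
under eq_bigr do rewrite mulr1; apply: (@sum_prod1 (fun=> bernoulli_pmf p)) => i.
exact: bernoulli_pmf_sum1.
Qed.

Lemma product_weight_sum1 : \sum_x product_weight x = 1.
Proof.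
have := sum_product_weight2 (fun=> 1); under eq_bigr do rewrite mulr1.
by move=> ->; under eq_bigr do rewrite mulr1; exact: sum_prod1.
Qed.

Definition product_law : probability (coins I) R :=
  coin_law product_weight_ge0 product_weight_sum1.

End product_law.

(** * The observation model with two-valued noise *)

Section independence.
Context {R : realType} {m : nat}.
Local Notation I := ('I_m * 'I_m)%type.
Variables (p : R) (q : I -> bool -> R).
Hypotheses (p01 : 0 <= p <= 1) (q0 : forall i t, 0 <= q i t)
  (q1 : forall i, \sum_t q i t = 1).
Local Notation P := (product_law p01 q0 q1).

Lemma product_lawE (A : set (coins I)) :
  P A = (\sum_x product_weight p q x * (x \in A)%:R)%:E.
Proof. exact: coin_lawE. Qed.

Lemma expectation_product_law (f : coins I -> R) :
  ('E_P[f] = (\sum_x product_weight p q x * f x)%:E)%E.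
Proof. exact: expectation_coin_law. Qed.

(** An event of the i-th entry is determined by the i-th boolean, and so is
    read off at the constant configurations. *)
Lemma coordinate_independent d (V : measurableType d) (X : coins I -> 'M[V]_m)
    (pr : coins I -> {ffun I -> bool}) (f : I -> bool -> V) (l : I -> bool -> R) :
  (forall c, pr (c, c) = c) ->
  (forall i, \sum_t l i t = 1) ->
  (forall x i j, X x i j = f (i, j) (pr x (i, j))) ->
  (forall u : {ffun I -> bool} -> R, \sum_x product_weight p q x * u (pr x) =
    \sum_(c : {ffun I -> bool}) (\prod_i l i (c i)) * u c) ->
  independent_entries P X.
Proof.
move=> prK l1 Xf lE J E EJ.
pose e i t : bool := (([ffun=> t], [ffun=> t]) : coins I) \in E i.
have eE i x : i \in J -> (x \in E i) = e i (pr x i).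
  rewrite /e => /EJ [Y _ <-].
  have XE : X ([ffun=> pr x i], [ffun=> pr x i]) i.1 i.2 = X x i.1 i.2.
    by rewrite !Xf -surjective_pairing prK ffunE.
  by apply/idP/idP => /set_mem [_ h]; apply/mem_set; split; move: h; rewrite /= ?XE.
have PE i : i \in J -> P (E i) = (\sum_t l i t * (e i t)%:R)%:E.
  move=> iJ; rewrite product_lawE.
  under eq_bigr do rewrite eE//.
  rewrite (lE (fun c => (e i (c i))%:R)).
  have := @sum_prod_factor R I l l1 (finset.set1 i) (fun i t => (e i t)%:R).
  rewrite big_set1 => <-; congr (_%:E); apply: eq_bigr => c _.
  by rewrite big_set1.
rewrite (eq_bigr _ PE) prodEFin -(sum_prod_factor l1) product_lawE.
rewrite -(lE (fun c => \prod_(i in J) (e i (c i))%:R)).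
congr (_%:E); apply: eq_bigr => x _; congr (_ * _).
have [xE|xE] := boolP (x \in \bigcap_(i in [set` J]) E i).
  rewrite big1// => i iJ; rewrite -eE//.
  by have -> : x \in E i by apply/mem_set; exact: (set_mem xE).
have [i iJ ni] : exists2 i, i \in J & x \notin E i.
  apply/exists_inP; move: xE; apply: contraNT; rewrite negb_exists_in.
  by move=> /forall_inP h; apply/mem_set => i /= /h; rewrite negbK => /set_mem.
by rewrite (bigD1 i)//= -eE// (negbTE ni) mul0r.
Qed.

Lemma halves_independent d1 d2 (V1 : measurableType d1) (V2 : measurableType d2)
    (X : coins I -> 'M[V1]_m) (Y : coins I -> 'M[V2]_m) :
  (forall x y, x.1 = y.1 -> X x = X y) -> (forall x y, x.2 = y.2 -> Y x = Y y) ->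
  independent_matrices P X Y.
Proof.
move=> X1 Y2 J E EJ.
pose c0 : {ffun I -> bool} := [ffun=> true].
have Etrue : true \in J -> forall x, (x \in E true) = ((x.1, c0) \in E true).
  move=> /EJ [S _ <-] x; have XE := X1 x (x.1, c0) erefl.
  by apply/idP/idP => /set_mem [_ h]; apply/mem_set; split; move: h; rewrite /= ?XE.
have Efalse : false \in J -> forall x, (x \in E false) = ((c0, x.2) \in E false).
  move=> /EJ [S _ <-] x; have YE := Y2 x (c0, x.2) erefl.
  by apply/idP/idP => /set_mem [_ h]; apply/mem_set; split; move: h; rewrite /= ?YE.
rewrite (big_mkcond (fun b => b \in J)) big_bool /=.
have [tJ|tJ] := boolP (true \in J); have [fJ|fJ] := boolP (false \in J).
- have -> : \bigcap_(i in [set` J]) E i = E true `&` E false.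
    apply/seteqP; split => x /=; first by move=> h; split; apply: h.
    by move=> [h1 h2] [] _.
  rewrite !product_lawE -EFinM; congr (_%:E).
  pose u (b : {ffun I -> bool}) : R := ((b, c0) \in E true)%:R.
  pose v (c : {ffun I -> bool}) : R := ((c0, c) \in E false)%:R.
  transitivity (\sum_x product_weight p q x * (u x.1 * v x.2)).
    apply: eq_bigr => x _; congr (_ * _).
    by rewrite /u /v -Etrue// -Efalse// in_setI -natrM mulnb.
  rewrite sum_product_weight; congr (_ * _).
    rewrite -(sum_product_weight1 p q1 u); apply: eq_bigr => x _.
    by rewrite /u -Etrue.
  rewrite -(sum_product_weight2 p q v); apply: eq_bigr => x _.
  by rewrite /v -Efalse.
- rewrite mule1; congr (P _); apply/seteqP; split => x /=; first by apply.
  by move=> h [] //= h'; move: fJ; rewrite h'.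
- rewrite mul1e; congr (P _); apply/seteqP; split => x /=; first by apply.
  by move=> h [] //= h'; move: tJ; rewrite h'.
- rewrite mule1 -[RHS](probability_setT P); congr (P _).
  by apply/seteqP; split => x //= _ [] h'; [move: tJ|move: fJ]; rewrite h'.
Qed.

End independence.

Section two_point_model.
Context {R : realType} {m : nat}.
Local Notation I := ('I_m * 'I_m)%type.
Variables (n : nat) (U sigma : R) (M : 'M[R]_m) (y q : I -> bool -> R).
Hypotheses (nm : (n <= m ^ 2)%N) (m0 : (0 < m)%N).
Hypotheses (q0 : forall i t, 0 <= q i t) (q1 : forall i, \sum_t q i t = 1).
Hypothesis y_mean : forall i j, \sum_t q (i, j) t * y (i, j) t = M i j.
Hypothesis y_var : forall i j, \sum_t q (i, j) t * (y (i, j) t - M i j) ^+ 2 = sigma ^+ 2.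
Hypothesis y_bound : forall i j t, `|y (i, j) t - M i j| <= U.

Definition sampling_rate : R := n%:R / m%:R ^+ 2.

Lemma sampling_rate_itv : 0 <= sampling_rate <= 1.
Proof.
rewrite divr_ge0 ?sqr_ge0//= ler_pdivrMr ?exprn_gt0 ?ltr0n// mul1r.
by rewrite -natrX ler_nat.
Qed.

Local Notation P := (product_law sampling_rate_itv q0 q1).

Definition mask (x : coins I) : 'M[bool]_m := \matrix_(i, j) x.1 (i, j).

Definition two_point_noise (x : coins I) : 'M[R]_m :=
  \matrix_(i, j) (y (i, j) (x.2 (i, j)) - M i j).

Definition observation (b c : {ffun I -> bool}) : 'M[R * bool]_m :=
  \matrix_(i, j) ((b (i, j))%:R * y (i, j) (c (i, j)), b (i, j)).

Let expectation_entry i j (f : bool -> R) :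
  ('E_P[fun x => f (x.2 (i, j))] = (\sum_t q (i, j) t * f t)%:E)%E.
Proof.
rewrite expectation_product_law (sum_product_weight2 _ _ (fun c => f (c (i, j)))).
have := sum_prod_factor q1 (finset.set1 (i, j)) (fun _ => f).
rewrite big_set1 => <-; congr (_%:E); apply: eq_bigr => c _.
by rewrite big_set1.
Qed.

Lemma two_point_bernoulli_model : bernoulli_model P n U sigma mask two_point_noise.
Proof.
split.
- split.
  + by move=> i j; exact: coins_measurable_fun.
  + apply: (@coordinate_independent R m sampling_rate q sampling_rate_itv q0 q1
      _ _ mask fst (fun _ t => t) (fun _ => bernoulli_pmf sampling_rate)) => //.
    * by move=> _; exact: bernoulli_pmf_sum1.
    * by move=> x i j; rewrite mxE.
    * by move=> u; exact: sum_product_weight1.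
  + move=> i j; apply/funext => A.
    rewrite /pushforward product_lawE.
    pose u (b : {ffun I -> bool}) : R := (b (i, j) \in A)%:R.
    transitivity (\sum_x product_weight sampling_rate q x * u x.1)%:E.
      congr (_%:E); apply: eq_bigr => x _; rewrite /u.
      suff -> : (x \in (fun w => mask w i j) @^-1` A) = (x.1 (i, j) \in A) by [].
      have mE : mask x i j = x.1 (i, j) by rewrite mxE.
      apply/idP/idP => /set_mem h; apply/mem_set; first by rewrite -mE.
      by rewrite /preimage /= mE.
    rewrite sum_product_weight1//.
    have := @sum_prod_factor R I (fun _ => bernoulli_pmf sampling_rate)
      (fun _ => bernoulli_pmf_sum1 _) (finset.set1 (i, j)) (fun _ t => (t \in A)%:R).
    rewrite big_set1 big_bool /= bernoulli_probE ?sampling_rate_itv// => h.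
    rewrite !diracE -!EFinM -EFinD -h; congr (_%:E); apply: eq_bigr => b _.
    by rewrite big_set1.
- split.
  + by move=> i j; exact: coins_measurable_fun.
  + apply: (@coordinate_independent R m sampling_rate q sampling_rate_itv q0 q1
      _ _ two_point_noise snd (fun i t => y i t - M i.1 i.2) q) => //.
    * by move=> x i j; rewrite mxE.
    * by move=> u; exact: sum_product_weight2.
  + move=> i j; transitivity (expectation P (fun x => y (i, j) (x.2 (i, j)) - M i j)).
      by congr (expectation _ _); apply/funext => x; rewrite mxE.
    rewrite (expectation_entry i j (fun t => y (i, j) t - M i j)).
    under eq_bigr do rewrite mulrBr.
    by rewrite sumrB y_mean -mulr_suml q1 mul1r subrr.
  + move=> i j; transitivity (expectation P (fun x => (y (i, j) (x.2 (i, j)) - M i j) ^+ 2)).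
      by congr (expectation _ _); apply/funext => x; rewrite mxE.
    by rewrite (expectation_entry i j (fun t => (y (i, j) t - M i j) ^+ 2)) y_var.
  + by apply: aeW => x i j; rewrite mxE.
- by apply: halves_independent => x z h; apply/matrixP => i j; rewrite !mxE h.
Qed.

Lemma sup_expectation_two_point (A : set ('M[R]_m * R)) (phi : 'M[R * bool]_m -> R) :
  A (M, sigma) ->
  ((\sum_(b : {ffun I -> bool}) (\prod_i bernoulli_pmf sampling_rate (b i)) *
    \sum_(c : {ffun I -> bool}) (\prod_i q i (c i)) * phi (observation b c))%:E <=
  sup_expectation n U A phi)%E.
Proof.
move=> AM; apply: ereal_sup_ubound; exists (M, sigma); split => //.
exists default_measure_display, (coins I), P, mask, two_point_noise; split.
  exact: two_point_bernoulli_model.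
rewrite expectation_product_law; congr (_%:E).
rewrite -(pair_bigA _ (fun b c => product_weight sampling_rate q (b, c) *
   phi (data (M, sigma).1 (mask (b, c)) (two_point_noise (b, c)))))/=.
apply: eq_bigr => b _; rewrite mulr_sumr; apply: eq_bigr => c _.
rewrite /product_weight /= -mulrA; congr (_ * (_ * phi _)).
by apply/matrixP => i j; rewrite !mxE /= addrC subrK.
Qed.

End two_point_model.

(** * The second moment method *)

Section masked_data.
Context {R : realType} {I : finType}.
Implicit Types (b c : {ffun I -> bool}).

(** The unmasked coordinates do not affect h, so they sum out to 1 for both laws:
    both sides are sums over the values of the masked coordinates, the others
    being set to true. *)
Lemma sum_prod_masked b (q q' : I -> bool -> R) (h : {ffun I -> bool} -> R) :
  (forall i, \sum_t q i t = 1) -> (forall i, \sum_t q' i t = 1) ->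
  (forall i, b i -> q i =1 q' i) ->
  (forall c c', (forall i, b i -> c i = c' i) -> h c = h c') ->
  \sum_(c : {ffun I -> bool}) (\prod_i q i (c i)) * h c =
  \sum_(c : {ffun I -> bool}) (\prod_i q' i (c i)) * h c.
Proof.
move=> q1 q'1 qq' hb.
pose seen c : {ffun I -> bool} := [ffun i => if b i then c i else true].
have key (l : I -> bool -> R) : \sum_(c : {ffun I -> bool}) (\prod_i l i (c i)) * h c =
    \sum_(z : {ffun I -> bool}) (\prod_i \sum_(t | (if b i then t else true) == z i) l i t) * h z.
  rewrite (partition_big seen xpredT)//=; apply: eq_bigr => z _.
  rewrite bigA_distr_big_dep.
  rewrite mulr_suml; apply: eq_big => [c|c /eqP <-].
    apply/eqP/familyP => [<- i|cz]; first by rewrite unfold_in /= ffunE.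
    by apply/ffunP => i; rewrite ffunE; apply/eqP; have := cz i; rewrite unfold_in.
  by congr (_ * _); apply: hb => i bi; rewrite ffunE bi.
rewrite !key; apply: eq_bigr => z _; congr (_ * _); apply: eq_bigr => i _.
have [bi|nbi] := boolP (b i).
  by apply: eq_bigr => t _; exact: qq'.
case: (z i); last by rewrite !big_pred0.
by rewrite (eq_bigl xpredT)// q1 (eq_bigl xpredT)// q'1.
Qed.

End masked_data.

Lemma average_le_ereal (R : realType) (O : finType) (mu E : O -> R) (s : \bar R) :
  (forall o, 0 <= mu o) -> \sum_o mu o = 1 ->
  (forall o, mu o != 0 -> ((E o)%:E <= s)%E) ->
  ((\sum_o mu o * E o)%:E <= s)%E.
Proof.
move=> mu0 mu1; case: s => [r| |] h; last 2 first.
- exact: leey.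
- have [j mj] : exists j, mu j != 0.
    apply/existsP; apply: contraT; rewrite negb_exists => /forallP h'.
    move: mu1; rewrite big1 => [/eqP|o _]; first by rewrite eq_sym oner_eq0.
    by apply/eqP; have := h' o; rewrite negbK.
  by have := h j mj; rewrite leeNy_eq.
- rewrite lee_fin -[leRHS]mul1r -mu1 mulr_suml; apply: ler_sum => o _.
  have [->|mo] := eqVneq (mu o) 0; first by rewrite !mul0r.
  by rewrite ler_wpM2l// -lee_fin h.
Qed.

Section second_moment.
Context {R : realType} {m : nat}.
Local Notation I := ('I_m * 'I_m)%type.
Variables (n : nat) (U : R) (y q : I -> bool -> R).
Hypotheses (nm : (n <= m ^ 2)%N) (m0 : (0 < m)%N).
Hypotheses (q0 : forall i t, 0 <= q i t) (q1 : forall i, \sum_t q i t = 1).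
Hypothesis y_mean : forall i, \sum_t q i t * y i t = 0.
Hypothesis y_var : forall i, \sum_t q i t * y i t ^+ 2 = 1.
Hypothesis y_bound : forall i t, `|y i t| <= U.

Local Notation p := (@sampling_rate R m n).

Let mask_weight (b : {ffun I -> bool}) : R := \prod_i bernoulli_pmf p (b i).
Let noise_weight (c : {ffun I -> bool}) : R := \prod_i q i (c i).

(** The law of the two noise values under the alternative: as y has mean 0 and
    variance 1 under q, it has mean M. *)
Definition tilt (M : 'M[R]_m) (i : I) (t : bool) : R :=
  q i t * (1 + y i t * M i.1 i.2).

(* The likelihood ratio of the data, in which only the masked entries enter. *)
Let lratio (M : 'M[R]_m) (b c : {ffun I -> bool}) : R :=
  \prod_i (1 + (b i)%:R * y i (c i) * M i.1 i.2).

Let null_mean (F : {ffun I -> bool} -> {ffun I -> bool} -> R) : R :=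
  \sum_b mask_weight b * \sum_c noise_weight c * F b c.

Let tilt_sum1 M i : \sum_t tilt M i t = 1.
Proof.
under eq_bigr do rewrite /tilt mulrDr mulr1 mulrA.
by rewrite big_split /= -mulr_suml y_mean mul0r addr0 q1.
Qed.

Let tilt_mean M i : \sum_t tilt M i t * y i t = M i.1 i.2.
Proof.
transitivity (\sum_t (q i t * y i t + q i t * y i t ^+ 2 * M i.1 i.2)).
  by apply: eq_bigr => t _; rewrite /tilt; ring.
by rewrite big_split /= -mulr_suml y_mean y_var add0r mul1r.
Qed.

Let null_mean_lratio2 M M' : null_mean (fun b c => lratio M b c * lratio M' b c) =
  \prod_i \prod_j (1 + p * (M i j * M' i j)).
Proof.
rewrite /null_mean.
transitivity (\sum_(b : {ffun I -> bool}) \prod_i (bernoulli_pmf p (b i) *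
    (1 + (b i)%:R * (M i.1 i.2 * M' i.1 i.2)))).
  apply: eq_bigr => b _; rewrite big_split /=; congr (_ * _).
  transitivity (\sum_(c : {ffun I -> bool}) \prod_i (q i (c i) *
      ((1 + (b i)%:R * y i (c i) * M i.1 i.2) * (1 + (b i)%:R * y i (c i) * M' i.1 i.2)))).
    by apply: eq_bigr => c _; rewrite !big_split.
  rewrite -(bigA_distr_bigA (fun i t => q i t *
      ((1 + (b i)%:R * y i t * M i.1 i.2) * (1 + (b i)%:R * y i t * M' i.1 i.2)))).
  apply: eq_bigr => i _.
  transitivity (\sum_t (q i t + q i t * y i t * ((b i)%:R * (M i.1 i.2 + M' i.1 i.2)) +
     q i t * y i t ^+ 2 * ((b i)%:R * (b i)%:R * (M i.1 i.2 * M' i.1 i.2)))).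
    by apply: eq_bigr => t _; ring.
  rewrite !big_split /= -!mulr_suml y_mean y_var q1 mul0r addr0 mul1r /=.
  by congr (1 + _ * _); case: (b i); rewrite ?mulr1 ?mulr0.
rewrite -(bigA_distr_bigA (fun (i : I) t => bernoulli_pmf p t *
    (1 + t%:R * (M i.1 i.2 * M' i.1 i.2)))).
rewrite pair_bigA; apply: eq_bigr => i _ /=.
by rewrite big_bool /=; ring.
Qed.

Let null_mean_lratio M : null_mean (lratio M) = 1.
Proof.
transitivity (null_mean (fun b c => lratio M b c * lratio 0 b c)).
  apply: eq_bigr => b _; congr (_ * _); apply: eq_bigr => c _; congr (_ * _).
  by rewrite [lratio 0 _ _]big1 ?mulr1// => i _; rewrite mxE mulr0 addr0.
rewrite null_mean_lratio2 big1// => i _; rewrite big1// => j _.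
by rewrite mxE !mulr0 addr0.
Qed.

Let null_meanD F G : null_mean (fun b c => F b c + G b c) = null_mean F + null_mean G.
Proof.
rewrite /null_mean -big_split; apply: eq_bigr => b _ /=; rewrite -mulrDr -big_split.
by congr (_ * _); apply: eq_bigr => c _; rewrite /= mulrDr.
Qed.

Let null_meanZ k F : null_mean (fun b c => k * F b c) = k * null_mean F.
Proof.
rewrite /null_mean [RHS]mulr_sumr; apply: eq_bigr => b _; rewrite [RHS]mulrCA.
by congr (_ * _); rewrite [RHS]mulr_sumr; apply: eq_bigr => c _; rewrite mulrCA.
Qed.

Let null_mean_sum (O : finType) (F : O -> _) :
  null_mean (fun b c => \sum_o F o b c) = \sum_o null_mean (F o).
Proof.
rewrite /null_mean [RHS]exchange_big; apply: eq_bigr => b _; rewrite -[RHS]mulr_sumr.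
by congr (_ * _); rewrite [RHS]exchange_big; apply: eq_bigr => c _; rewrite [LHS]mulr_sumr.
Qed.

Let mask_weight_ge0 b : 0 <= mask_weight b.
Proof.
by apply: prodr_ge0 => i _; apply: bernoulli_pmf_ge0; exact: sampling_rate_itv.
Qed.

Let noise_weight_ge0 c : 0 <= noise_weight c. Proof. by apply: prodr_ge0. Qed.

Let ler_null_mean F G : (forall b c, F b c <= G b c) -> null_mean F <= null_mean G.
Proof.
move=> FG; apply: ler_sum => b _; rewrite ler_wpM2l//.
by apply: ler_sum => c _; rewrite ler_wpM2l.
Qed.

Let null_mean1 : null_mean (fun _ _ => 1) = 1.
Proof.
rewrite -[RHS](null_mean_lratio 0); apply: eq_bigr => b _; congr (_ * _).
apply: eq_bigr => c _; congr (_ * _).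
by rewrite [RHS]big1// => i _; rewrite mxE mulr0 addr0.
Qed.

(* Outside the mask the observation does not depend on the noise, so there the
   tilted law may be replaced by the untilted one. *)
Let null_mean_tilt M (h : 'M[R * bool]_m -> R) :
  \sum_(b : {ffun I -> bool}) (\prod_i bernoulli_pmf p (b i)) *
    \sum_(c : {ffun I -> bool}) (\prod_i tilt M i (c i)) * h (observation y b c) =
  null_mean (fun b c => lratio M b c * h (observation y b c)).
Proof.
apply: eq_bigr => b _; congr (_ * _).
pose q' i t := q i t * (1 + (b i)%:R * y i t * M i.1 i.2).
rewrite (@sum_prod_masked R I b _ q').
- apply: eq_bigr => c _; rewrite mulrA; congr (_ * _).
  by rewrite /q' big_split.
- by move=> i; exact: tilt_sum1.
- move=> i; rewrite /q'; case: (b i) => /=.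
    by under eq_bigr do rewrite mul1r; exact: tilt_sum1.
  by under eq_bigr do rewrite !mul0r addr0 mulr1; exact: q1.
- by move=> i bi t; rewrite /tilt /q' bi mul1r.
- move=> c c' cc; congr (h _); apply/matrixP => i j; rewrite !mxE.
  by case: (boolP (b (i, j))) => [/cc ->//|]; rewrite !mul0r.
Qed.

(** With L the likelihood ratio of the mixture, the risk is at least the null mean
    of min (1, L), and 1 - L is at most e / 2 + (L - 1) ^ 2 / (2 e). Only the matrices
    of positive weight have to be alternatives. *)
Lemma testing_risk_second_moment (A0 A1 : set ('M[R]_m * R)) (O : finType)
    (mu : O -> R) (Mo : O -> 'M[R]_m) (sigma e : R) (Psi : 'M[R * bool]_m -> bool) :
  0 < e -> (forall o, 0 <= mu o) -> \sum_o mu o = 1 ->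
  A0 (0, 1) ->
  (forall o, mu o != 0 -> [/\ A1 (Mo o, sigma),
     forall i t, 0 <= 1 + y i t * Mo o i.1 i.2,
     forall i, \sum_t tilt (Mo o) i t * (y i t - Mo o i.1 i.2) ^+ 2 = sigma ^+ 2 &
     forall i t, `|y i t - Mo o i.1 i.2| <= U]) ->
  \sum_o \sum_o' mu o * mu o' *
    \prod_i \prod_j (1 + p * (Mo o i j * Mo o' i j)) <= 1 + e ^+ 2 ->
  ((1 - e)%:E <= testing_risk n U A0 A1 Psi)%E.
Proof.
move=> e0 mu0 mu1 A00 A1o chi2.
pose psi b c : R := (Psi (observation y b c))%:R.
pose L b c := \sum_o mu o * lratio (Mo o) b c.
have null : ((null_mean psi)%:E <= sup_expectation n U A0 (fun x => (Psi x)%:R%R))%E.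
  apply: (@sup_expectation_two_point R m n U 1 0 y q nm m0 q0 q1) => //.
  - by move=> i j; rewrite y_mean mxE.
  - move=> i j; rewrite expr1n -[RHS](y_var (i, j)).
    by apply: eq_bigr => t _; rewrite mxE subr0.
  - by move=> i j t; rewrite mxE subr0.
have alt : ((\sum_o mu o * null_mean (fun b c => lratio (Mo o) b c * (1 - psi b c)))%:E <=
    sup_expectation n U A1 (fun x => (1 - (Psi x)%:R)%R))%E.
  apply: average_le_ereal => // o /A1o [A1oo pos var bnd].
  rewrite -(null_mean_tilt (Mo o) (fun x => 1 - (Psi x)%:R)).
  have t0 i t : 0 <= tilt (Mo o) i t by rewrite mulr_ge0.
  apply: (@sup_expectation_two_point R m n U sigma (Mo o) y (tilt (Mo o)) nm m0 t0
    (tilt_sum1 (Mo o)) (fun i j => tilt_mean (Mo o) (i, j)) (fun i j => var (i, j))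
    (fun i j t => bnd (i, j) t)).
  exact: A1oo.
apply: (le_trans _ (leeD null alt)); rewrite -EFinD lee_fin.
have -> : \sum_o mu o * null_mean (fun b c => lratio (Mo o) b c * (1 - psi b c)) =
    null_mean (fun b c => L b c * (1 - psi b c)).
  under eq_bigr do rewrite -null_meanZ.
  rewrite -null_mean_sum; apply: eq_bigr => b _; congr (_ * _).
  apply: eq_bigr => c _; congr (_ * _); rewrite /L mulr_suml.
  by apply: eq_bigr => o _; rewrite mulrA.
rewrite -null_meanD.
have EL : null_mean L = 1.
  rewrite /L null_mean_sum; under eq_bigr do rewrite null_meanZ null_mean_lratio mulr1.
  exact: mu1.
have EL2 : null_mean (fun b c => L b c ^+ 2) <= 1 + e ^+ 2.
  apply: le_trans chi2; rewrite le_eqVlt; apply/orP; left; apply/eqP.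
  transitivity (null_mean (fun b c => \sum_o \sum_o' mu o * mu o' * (lratio (Mo o) b c * lratio (Mo o') b c))).
    apply: eq_bigr => b _; congr (_ * _); apply: eq_bigr => c _; congr (_ * _).
    rewrite /L expr2 big_distrlr; apply: eq_bigr => o _; apply: eq_bigr => o' _ /=.
    by rewrite mulrACA.
  rewrite null_mean_sum; apply: eq_bigr => o _; rewrite null_mean_sum.
  by apply: eq_bigr => o' _; rewrite null_meanZ null_mean_lratio2.
apply: le_trans (_ : null_mean (fun b c => (1 - e / 2 - (2 * e)^-1) +
    (e^-1 * L b c + - (2 * e)^-1 * L b c ^+ 2)) <= _).
  rewrite (null_meanD (fun _ _ => 1 - e / 2 - (2 * e)^-1)
    (fun b c => e^-1 * L b c + - (2 * e)^-1 * L b c ^+ 2)).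
  rewrite (null_meanD (fun b c => e^-1 * L b c) (fun b c => - (2 * e)^-1 * L b c ^+ 2)).
  rewrite (null_meanZ e^-1 L) (null_meanZ _ (fun b c => L b c ^+ 2)) EL.
  have -> : null_mean (fun _ _ => 1 - e / 2 - (2 * e)^-1) = 1 - e / 2 - (2 * e)^-1.
    transitivity ((1 - e / 2 - (2 * e)^-1) * null_mean (fun _ _ => 1)).
      rewrite -null_meanZ; apply: eq_bigr => b _; congr (_ * _).
      by apply: eq_bigr => c _; rewrite mulr1.
    by rewrite null_mean1 mulr1.
  have h : (2 * e)^-1 * null_mean (fun b c => L b c ^+ 2) <= (2 * e)^-1 * (1 + e ^+ 2).
    by rewrite ler_wpM2l// invr_ge0 mulr_ge0// ltW.
  have -> : 1 - e = 1 - e / 2 - (2 * e)^-1 + (e^-1 * 1 - (2 * e)^-1 * (1 + e ^+ 2)).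
    by field; rewrite gt_eqF.
  by rewrite lerD2l lerD2l mulNr lerN2.
apply: ler_null_mean => b c; set l := L b c.
(* Both differences are a multiple of a square, (l - 1) ^ 2 and (l - 1 + e) ^ 2, up to
   the positive term e / 2. *)
have sq : 1 - e / 2 - (2 * e)^-1 + (e^-1 * l + - (2 * e)^-1 * l ^+ 2) <= Num.min 1 l.
  have p1 : 0 <= (2 * e)^-1 * (l - 1) ^+ 2.
    by rewrite mulr_ge0 ?sqr_ge0// invr_ge0 mulr_ge0// ltW.
  have p2 : 0 <= (2 * e)^-1 * (l - 1 + e) ^+ 2.
    by rewrite mulr_ge0 ?sqr_ge0// invr_ge0 mulr_ge0// ltW.
  rewrite le_min; apply/andP; split.
    rewrite -subr_ge0; apply: le_trans (addr_ge0 p1 (_ : 0 <= e / 2)) _; last first.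
      by rewrite le_eqVlt; apply/orP; left; apply/eqP; field; rewrite gt_eqF.
    by rewrite divr_ge0// ltW.
  rewrite -subr_ge0; apply: le_trans p2 _.
  by rewrite le_eqVlt; apply/orP; left; apply/eqP; field; rewrite gt_eqF.
apply: (le_trans sq); rewrite /psi; case: (Psi _);
  rewrite ?subrr ?subr0 ?mulr0 ?mulr1 ?addr0 ?add0r ge_min lexx ?orbT//.
Qed.

End second_moment.

(** * Alternatives and two-point laws *)

Section alternatives.
Context {R : realType} (m k' : nat).
Local Notation k := k'.+1.
Local Notation b := (m %/ k).+1.
Local Notation sg b := ((-1) ^+ b : R).
Local Notation S o := (@sign_matrix R m k' o).

Lemma sign_matrix_sq (o : prior_index m k') i j : S o i j ^+ 2 = 1.
Proof. by rewrite mxE -signr_addb sqrr_sign. Qed.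

Lemma sign_matrix_norm (o : prior_index m k') i j : `|S o i j| = 1.
Proof. by rewrite mxE -signr_addb normr_sign. Qed.

(** S is the product of the row signs by the signed incidence matrix of the
    groups. *)
Lemma rank_sign_matrix (o : prior_index m k') : (\rank (S o) <= k)%N.
Proof.
pose X : 'M[R]_(m, k) := \matrix_(i, g) sg (o.2.2 i g).
pose Y : 'M[R]_(k, m) := \matrix_(g, j) (if g == column_group o.1 j then sg (o.2.1 j) else 0).
suff -> : S o = X *m Y by exact: mulmx_max_rank.
apply/matrixP => i j; rewrite !mxE (bigD1 (column_group o.1 j))//= !mxE eqxx.
by rewrite big1 ?addr0// => g /negbTE gj; rewrite !mxE gj mulr0.
Qed.

Lemma scaled_sign_matrix_bounded (a s : R) o : 0 <= s <= a ->
  bounded_low_rank a k (s *: S o).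
Proof.
move=> /andP[s0 sa]; split.
  rewrite [mx_norm _]mx_normrE; apply/bigmax_leP; split; first exact: le_trans sa.
  by move=> [i j] _ /=; rewrite mxE normrM sign_matrix_norm mulr1 ger0_norm.
exact: leq_trans (mxrank_scale _ _) (rank_sign_matrix o).
Qed.

(** The singular values are so evenly spread that the k0 largest ones account for
    at most 3 / 4 of the squared norm m ^ 2. *)
Definition spread (k0 : nat) (o : prior_index m k') : bool :=
  16 * k0%:R * gram_energy (S o) <= 9 * m%:R ^+ 4.

Lemma spread_distance (k0 : nat) (s : R) o (A : 'M[R]_m) : 0 <= s ->
  spread k0 o -> (\rank A <= k0)%N ->
  (s * m%:R / 2) ^+ 2 <= sqnorm (s *: S o - A).
Proof.
move=> s0 So Ak.
pose c := 3 / 4 * (s ^+ 2 * m%:R ^+ 2).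
have c0 : 0 <= c by apply: mulr_ge0 => //; apply: mulr_ge0; exact: sqr_ge0.
have sqS : sqnorm (s *: S o) = s ^+ 2 * m%:R ^+ 2.
  rewrite /sqnorm; under eq_bigr do under eq_bigr do
    rewrite mxE exprMn sign_matrix_sq mulr1.
  by rewrite !sumr_const !card_ord -[LHS]mulr_natr -[X in X * _]mulr_natr; ring.
have := @low_rank_distance R m m (s *: S o)^T A^T k0 c.
rewrite mxrank_tr trmxK -linearB /= !sqnorm_tr sqS => /(_ Ak c0) h.
apply: le_trans (h _); first by rewrite le_eqVlt; apply/orP; left; apply/eqP; rewrite /c; field.
have -> : sqnorm (s *: S o *m (s *: S o)^T) = s ^+ 4 * gram_energy (S o).
  rewrite /sqnorm /gram_energy mulr_sumr; apply: eq_bigr => i _.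
  rewrite mulr_sumr; apply: eq_bigr => j _.
  by rewrite linearZ /= -scalemxAl -scalemxAr !mxE; ring.
have -> : c ^+ 2 = s ^+ 4 / 16 * (9 * m%:R ^+ 4) by rewrite /c; field.
have -> : k0%:R * (s ^+ 4 * gram_energy (S o)) =
    s ^+ 4 / 16 * (16 * k0%:R * gram_energy (S o)) by field.
by rewrite ler_wpM2l// divr_ge0// exprn_ge0.
Qed.

(** Markov's inequality for the Gram energy, whose mean is at most
    m ^ 3 (1 + b) <= 3 m ^ 4 / k. *)
Lemma spread_fraction (k0 : nat) (delta : R) : (0 < m)%N -> (k <= m)%N ->
  k0%:R <= delta * k%:R ->
  1 - 6 * delta <= mean (fun o => (spread k0 o)%:R).
Proof.
move=> m0 km k0k.
have mR : 0 < m%:R :> R by rewrite ltr0n.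
have kR : 0 < k%:R :> R by rewrite ltr0n.
have m4 : 0 < 9 * m%:R ^+ 4 :> R by rewrite mulr_gt0// exprn_gt0.
pose C : R := 16 * k0%:R / (9 * m%:R ^+ 4).
have C0 : 0 <= C by apply: divr_ge0; [exact: mulr_ge0|exact: ltW].
have markov o : 1 - C * gram_energy (S o) <= (spread k0 o)%:R.
  rewrite /spread; have [h|h] := leP (16 * k0%:R * gram_energy (S o)) (9 * m%:R ^+ 4).
    rewrite -[leRHS]/1 gerBl; apply: mulr_ge0 => //.
    by apply: sumr_ge0 => i _; apply: sumr_ge0 => j _; exact: sqr_ge0.
  rewrite subr_le0 /C mulrAC ler_pdivlMr// mul1r ltW//.
apply: le_trans (ler_mean markov).
under eq_mean do rewrite -mulNr.
rewrite meanD meanZl mean_cst ?prior_index_gt0// lerD2l mulNr lerN2.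
apply: le_trans (ler_wpM2l C0 (@mean_gram_energy_le R m k')) _.
have bound : k%:R * (1 + b%:R) <= 3 * m%:R :> R.
  rewrite mulrDr mulr1 -!natrM -!natrD ler_nat.
  by have := block_number_bound km; lia.
rewrite -(ler_pM2r kR) /C.
have -> : 16 * k0%:R / (9 * m%:R ^+ 4) * (m%:R ^+ 3 * (1 + b%:R)) * k%:R =
    16 / 9 * (k%:R * (1 + b%:R)) / m%:R * k0%:R :> R.
  by field; rewrite gt_eqF.
apply: (le_trans (_ : _ <= 16 / 9 * (3 * m%:R) / m%:R * k0%:R)).
  by rewrite ler_wpM2r// ler_wpM2r ?invr_ge0// ler_wpM2l.
have -> : 16 / 9 * (3 * m%:R) / m%:R * k0%:R = 16 / 3 * k0%:R :> R.
  by field; rewrite gt_eqF.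
have : 0 <= k0%:R :> R by [].
lra.
Qed.

End alternatives.

Section two_point.
Context {R : realType} {I : finType}.
Variable v : I -> R.
Hypothesis v0 : forall i, 0 < v i.

Definition two_point_value (i : I) (t : bool) : R := if t then v i else - (v i)^-1.

(** The weights for which the values v and - 1 / v have mean 0; their variance is
    then 1. *)
Definition two_point_weight (i : I) (t : bool) : R :=
  (if t then 1 else v i ^+ 2) / (1 + v i ^+ 2).

Let d0 i : 0 < 1 + v i ^+ 2.
Proof. by rewrite ltr_pwDl ?sqr_ge0. Qed.

Lemma two_point_weight_ge0 i t : 0 <= two_point_weight i t.
Proof. by rewrite divr_ge0 ?(ltW (d0 i))//; case: t => //; exact: sqr_ge0. Qed.

Lemma two_point_weight_sum1 i : \sum_t two_point_weight i t = 1.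
Proof. by rewrite big_bool /two_point_weight /= -mulrDl divff// gt_eqF. Qed.

Lemma two_point_mean i : \sum_t two_point_weight i t * two_point_value i t = 0.
Proof.
rewrite big_bool /two_point_weight /two_point_value /=; field.
by rewrite !gt_eqF.
Qed.

Lemma two_point_var i : \sum_t two_point_weight i t * two_point_value i t ^+ 2 = 1.
Proof.
rewrite big_bool /two_point_weight /two_point_value /=; field.
by rewrite !gt_eqF.
Qed.

(** The variance after tilting to mean x; the last term comes from the third
    moment v - 1 / v. It is 1 - x ^ 2 for v = 1, and 1 if v - 1 / v = x. *)
Lemma two_point_tilted_var i (x : R) :
  \sum_t two_point_weight i t * (1 + two_point_value i t * x) * (two_point_value i t - x) ^+ 2 =
  1 - x ^+ 2 + x * (v i - (v i)^-1).
Proof.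
rewrite big_bool /two_point_weight /two_point_value /=; field.
by rewrite !gt_eqF.
Qed.

End two_point.

(** * Risk bounds for given dimensions *)

Section fixed_dimensions.
Context {R : realType}.

Lemma le_dist_to (X : Type) (D : X -> X -> R) (x : X) (A : set X) (c : R) :
  A !=set0 -> (forall z, A z -> c <= D x z) -> c <= dist_to D x A.
Proof.
move=> [z Az] h; apply: lb_le_inf; first by exists (D x z), z.
by move=> _ [u Au <-]; exact: h.
Qed.

Lemma frobenius_dist_ge m (M A : 'M[R]_m) (c : R) :
  0 <= c -> c ^+ 2 <= sqnorm (M - A) -> c <= frobenius_dist M A.
Proof.
move=> c0 h; rewrite -[leLHS]ger0_norm// -sqrtr_sqr ler_sqrt//.
exact: sqnorm_ge0.
Qed.

Lemma zero_bounded_low_rank m (a : R) k0 : 0 <= a -> bounded_low_rank a k0 (0 : 'M[R]_m).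
Proof. by move=> a0; split; [rewrite mx_norm0|rewrite mxrank0]. Qed.

Lemma spread_dist_to m k' k0 (a s : R) (o : prior_index m k') : 0 <= a -> 0 <= s ->
  spread (R := R) k0 o ->
  s * m%:R / 2 <= dist_to frobenius_dist (s *: sign_matrix o) (bounded_low_rank a k0).
Proof.
move=> a0 s0 So; apply: le_dist_to => [|A [_ Ak]].
  by exists 0; exact: zero_bounded_low_rank.
apply: frobenius_dist_ge; last exact: (spread_distance s0 So Ak).
by rewrite divr_ge0// mulr_ge0.
Qed.

(** The prior is uniform on the spread sign matrices. As the overlap products are
    nonnegative, its second moment is at most the one of the full prior divided by
    the square of the fraction of spread matrices. *)
Lemma unknown_variance_risk (n m k' k0 : nat) (a U rho e eta : R)
    (Psi : 'M[R * bool]_m -> bool) :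
  (n <= m ^ 2)%N -> (0 < m)%N -> (k'.+1 ^ 2 <= m)%N -> 2 <= U -> 0 < rho < 1 / 2 ->
  2 * rho <= a -> 0 < e -> eta <= 1 / 200 -> 20 * eta <= e ^+ 2 ->
  k0%:R <= eta * k'.+1%:R ->
  (@sampling_rate R m n * (2 * rho) ^+ 2) ^+ 2 * m%:R ^+ 2 <= eta * k'.+1%:R ->
  ((1 - e)%:E <= testing_risk n U (null_hypothesis m a k0)
     (alternative_hypothesis m a k0 k'.+1 rho) Psi)%E.
Proof.
move=> nm m0 km U2 /andP[rho0 rho12] rhoa e0 eta200 etae k0k xm.
pose s := 2 * rho; have s0 : 0 <= s by rewrite mulr_ge0// ltW.
have a0 : 0 <= a by apply: le_trans rhoa.
have s1 : s <= 1 by rewrite /s; lra.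
have kleqm : (k'.+1 <= m)%N by apply: leq_trans km; rewrite expnS expn1 leq_pmulr.
have /andP[p0 p1] := @sampling_rate_itv R m n nm m0.
set p := sampling_rate n in xm p0 p1.
pose x := p * s ^+ 2.
have x0 : 0 <= x by rewrite mulr_ge0 ?sqr_ge0.
have x1 : x <= 1.
  apply: (le_trans (_ : _ <= p * 1)); last by rewrite mulr1.
  by rewrite ler_wpM2l// expr_le1.
have eta0 : 0 <= eta.
  by rewrite -(pmulr_lge0 _ (ltr0Sn R k')); apply: le_trans k0k.
pose N : R := #|prior_index m k'|%:R.
have N0 : 0 < N by rewrite ltr0n prior_index_gt0.
pose G : R := \sum_(o : prior_index m k') (spread (R := R) k0 o)%:R.
have GN : (1 - 6 * eta) * N <= G.
  by rewrite -ler_pdivlMr//; exact: spread_fraction.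
have eta6 : 0 < 1 - 6 * eta by lra.
have G0 : 0 < G by apply: lt_le_trans GN; exact: mulr_gt0.
pose mu (o : prior_index m k') : R := (spread (R := R) k0 o)%:R / G.
have mu0 o : 0 <= mu o by rewrite divr_ge0// ltW.
have v0 (i : 'I_m * 'I_m) : 0 < 1 :> R by [].
pose y := two_point_value (fun _ : 'I_m * 'I_m => 1 : R).
pose q := two_point_weight (fun _ : 'I_m * 'I_m => 1 : R).
have yE i t : y i t = (-1) ^+ (~~ t).
  by case: t; rewrite /y /two_point_value /= ?expr0 ?expr1 ?invr1.
have entry (o : prior_index m k') i j : (s *: sign_matrix (R := R) o) i j = s \/
    (s *: sign_matrix (R := R) o) i j = - s.
  rewrite !mxE -signr_addb; case: (_ (+) _); rewrite /= ?expr0 ?expr1; first by right; rewrite mulrN1.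
  by left; rewrite mulr1.
have q0 i t : 0 <= q i t by exact: two_point_weight_ge0.
have q1 i : \sum_t q i t = 1 by exact: two_point_weight_sum1.
have yq i : \sum_t q i t * y i t = 0 by exact: two_point_mean.
have yyq i : \sum_t q i t * y i t ^+ 2 = 1 by exact: two_point_var.
clear v0.
have yU i t : `|y i t| <= U by rewrite yE normr_sign; lra.
apply: (@testing_risk_second_moment R m n U y q nm m0 q0 q1 yq yyq yU _ _ _ mu
  (fun o => s *: sign_matrix o) (Num.sqrt (1 - 4 * rho ^+ 2))) => //.
- by rewrite -mulr_suml divff// gt_eqF.
- by split => //; exact: zero_bounded_low_rank.
- move=> o; rewrite /mu mulf_eq0 negb_or => /andP[].
  case: (boolP (spread k0 o)) => [So _ _|]; last by rewrite eqxx.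
  split.
  + split => //=; first by apply: scaled_sign_matrix_bounded; rewrite s0.
    have h := spread_dist_to a0 s0 So.
    have -> : m%:R ^+ 2 * rho ^+ 2 = (s * m%:R / 2) ^+ 2 by rewrite /s; field.
    rewrite ler_sqr ?nnegrE//; first by rewrite divr_ge0// mulr_ge0.
    by apply: le_trans h; rewrite divr_ge0// mulr_ge0.
  + move=> i t; rewrite yE; case: (entry o i.1 i.2) => ->; case: t;
      rewrite /= ?expr0 ?expr1; lra.
  + move=> i; have := @two_point_tilted_var R _ (fun _ : 'I_m * 'I_m => 1 : R) (fun=> ltr01) i
      ((s *: sign_matrix (R := R) o) i.1 i.2).
    rewrite invr1 subrr mulr0 addr0 => ->.
    rewrite sqr_sqrtr.
      by case: (entry o i.1 i.2) => ->; rewrite ?sqrrN /s; ring.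
    have : rho * rho <= 1 / 2 * (1 / 2) by apply: ler_pM; lra.
    lra.
  + move=> i t; rewrite yE ler_norml; case: (entry o i.1 i.2) => ->; case: t;
      rewrite /= ?expr0 ?expr1; apply/andP; split; lra.
have := @mean_overlap_le R m k' x eta x0 km xm eta200.
set F := fun o o' : prior_index m k' =>
  \prod_i \prod_j (1 + x * (sign_matrix o i j * sign_matrix o' i j)).
rewrite -/(mean (fun o => mean (F o))) => overlap.
have F0 o o' : 0 <= F o o'.
  apply: prodr_ge0 => i _; apply: prodr_ge0 => j _.
  rewrite !mxE -!signr_addb; case: (_ (+) _); rewrite /= ?expr0 ?expr1; lra.
have step1 : \sum_o \sum_o' mu o * mu o' *
    \prod_i \prod_j (1 + p * ((s *: sign_matrix o) i j * (s *: sign_matrix o') i j)) <=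
    (N / G) ^+ 2 * expR (2 * eta).
  apply: (le_trans (_ : _ <= (N / G) ^+ 2 * mean (fun o => mean (F o)))); last first.
    by rewrite ler_wpM2l ?sqr_ge0.
  have -> : (N / G) ^+ 2 * mean (fun o => mean (F o)) = \sum_o \sum_o' G^-1 * G^-1 * F o o'.
    rewrite /mean -/N -mulr_suml.
    transitivity (G^-1 * G^-1 * \sum_o \sum_o' F o o').
      by field; rewrite !gt_eqF.
    by rewrite mulr_sumr; apply: eq_bigr => o _; rewrite mulr_sumr.
  apply: ler_sum => o _; apply: ler_sum => o' _.
  have -> : \prod_i \prod_j (1 + p * ((s *: sign_matrix o) i j * (s *: sign_matrix o') i j)) = F o o'.
    apply: eq_bigr => i _; apply: eq_bigr => j _.
    by rewrite [(_ *: sign_matrix o) i j]mxE [(_ *: sign_matrix o') i j]mxE /x; ring.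
  rewrite ler_wpM2r//.
  have mule (o1 : prior_index m k') : mu o1 <= G^-1.
    by rewrite /mu ler_piMl ?invr_ge0 ?(ltW G0)//; case: (spread _ _).
  by apply: ler_pM.
apply: (le_trans step1).
have NG : N / G <= (1 - 6 * eta)^-1.
  by rewrite ler_pdivrMr// mulrC ler_pdivlMr// mulrC.
have eta40 : 2 * eta <= 1 / 2 by lra.
have E1 : expR (2 * eta) <= 1 + 4 * eta.
  apply: le_trans (expR_quadratic_le eta40) _.
  have : eta * eta <= eta * (1 / 200) by rewrite ler_wpM2l.
  lra.
have E2 : (N / G) ^+ 2 <= 1 + 15 * eta.
  apply: (le_trans (_ : _ <= (1 - 6 * eta)^-1 ^+ 2)).
    by rewrite ler_sqr// nnegrE ?invr_ge0 ?(ltW eta6)// divr_ge0// ltW.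
  rewrite exprVn -[leLHS]mul1r ler_pdivrMr ?exprn_gt0//.
  have e2 : 0 <= eta * eta by apply: mulr_ge0.
  have e3 : eta * eta <= eta * (1 / 200) by rewrite ler_wpM2l.
  have e4 : 0 <= eta * (eta * eta) by apply: mulr_ge0.
  lra.
apply: (le_trans (ler_pM (sqr_ge0 _) (expR_ge0 _) E2 E1)).
have : eta * eta <= eta * (1 / 200) by rewrite ler_wpM2l.
lra.
Qed.

(** The value v > 0 for which the two-point law on v and - 1 / v keeps variance
    1 when tilted to mean x. *)
Definition balanced_value (x : R) : R := (x + Num.sqrt (x ^+ 2 + 4)) / 2.

Lemma balanced_value_gt0 x : 0 < balanced_value x.
Proof.
have xr : `|x| < Num.sqrt (x ^+ 2 + 4).
  by rewrite -sqrtr_sqr ltr_sqrt ?ltrDl// ltr_wpDl ?sqr_ge0.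
by rewrite divr_gt0//; move: xr; rewrite ltr_norml => /andP[]; lra.
Qed.

Lemma balanced_valueE x : balanced_value x - (balanced_value x)^-1 = x.
Proof.
have v0 := balanced_value_gt0 x.
have vv : balanced_value x ^+ 2 = 1 + x * balanced_value x.
  have r2 : Num.sqrt (x ^+ 2 + 4) ^+ 2 = x ^+ 2 + 4.
    by rewrite sqr_sqrtr// addr_ge0// sqr_ge0.
  by rewrite /balanced_value expr_div_n sqrrD r2; field.
move: (balanced_value x) v0 vv => v v0 vv.
have -> : v - v^-1 = (v ^+ 2 - 1) / v by field; rewrite gt_eqF.
by rewrite vv; field; rewrite gt_eqF.
Qed.

Lemma balanced_value_bound x : `|x| <= 1 ->
  balanced_value x <= 2 /\ (balanced_value x)^-1 <= 2.
Proof.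
rewrite ler_norml => /andP[x1 x2].
have := balanced_valueE x; have := balanced_value_gt0 x.
move: (balanced_value x) => v v0 vx.
have w0 : 0 < v^-1 by rewrite invr_gt0.
have vw : v * v^-1 = 1 by rewrite divff// gt_eqF.
move: (v^-1) w0 vw vx => w w0 vw vx.
by split; rewrite leNgt; apply/negP => h; nra.
Qed.

(** For a single alternative the second moment is the product of the
    1 + p M_ij ^ 2, at most the exponential of the squared norm of M. *)
Lemma known_variance_risk (n m : nat) (U e : R) (A0 A1 : set ('M[R]_m * R))
    (M : 'M[R]_m) (Psi : 'M[R * bool]_m -> bool) :
  (n <= m ^ 2)%N -> (0 < m)%N -> 2 <= U -> 0 < e ->
  (forall i j, `|M i j| <= 1) -> sqnorm M <= 1 / 2 -> 2 * sqnorm M <= e ^+ 2 ->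
  A0 (0, 1) -> A1 (M, 1) ->
  ((1 - e)%:E <= testing_risk n U A0 A1 Psi)%E.
Proof.
move=> nm m0 U2 e0 M1 Mhalf Me A00 A1M.
pose v (i : 'I_m * 'I_m) := balanced_value (M i.1 i.2).
have v0 i : 0 < v i by exact: balanced_value_gt0.
have vE i : v i - (v i)^-1 = M i.1 i.2 by exact: balanced_valueE.
have vU i : v i <= 2 /\ (v i)^-1 <= 2 by exact: balanced_value_bound.
have w0 i : 0 < (v i)^-1 by rewrite invr_gt0.
pose y := two_point_value v; pose q := two_point_weight v.
have q0 i t : 0 <= q i t by exact: two_point_weight_ge0.
have q1 i : \sum_t q i t = 1 by exact: two_point_weight_sum1.
have yq i : \sum_t q i t * y i t = 0 by exact: two_point_mean.
have yyq i : \sum_t q i t * y i t ^+ 2 = 1 by exact: two_point_var.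
have yU i t : `|y i t| <= U.
  apply: le_trans U2; have [h1 h2] := vU i; rewrite /y /two_point_value.
  by case: t; rewrite ?normrN gtr0_norm.
apply: (@testing_risk_second_moment R m n U y q nm m0 q0 q1 yq yyq yU _ _ unit
  (fun=> 1) (fun=> M) 1) => //.
- by rewrite sumr_const card_unit.
- move=> _ _; split => //.
  + move=> i t; rewrite -vE /y /two_point_value; case: t.
      have -> : 1 + v i * (v i - (v i)^-1) = v i ^+ 2 by field; rewrite gt_eqF.
      exact: sqr_ge0.
    have -> : 1 + - (v i)^-1 * (v i - (v i)^-1) = (v i)^-1 ^+ 2.
      by field; rewrite gt_eqF.
    exact: sqr_ge0.
  + move=> i; have := two_point_tilted_var v0 i (M i.1 i.2).
    by rewrite vE -expr2 subrK expr1n.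
  + move=> i t; apply: le_trans U2; have [h1 h2] := vU i.
    rewrite -vE /y /two_point_value; case: t.
      by rewrite opprB addrC subrK gtr0_norm.
    by rewrite opprB addrC addrAC subrr add0r normrN gtr0_norm.
rewrite !(big_pred1 tt) => [|[]|[]]//.
have /andP[p0 p1] := @sampling_rate_itv R m n nm m0.
rewrite !mul1r; apply: (le_trans (_ : _ <= expR (sqnorm M))).
  rewrite /sqnorm expR_sum; apply: ler_prod => i _; rewrite expR_sum.
  rewrite prodr_ge0 => [|j _]; last first.
    by rewrite addr_ge0// mulr_ge0// -expr2 sqr_ge0.
  have M20 j : 0 <= M i j ^+ 2 by exact: sqr_ge0.
  apply: ler_prod => j _; rewrite -expr2 addr_ge0 ?(mulr_ge0 p0 (M20 j))//=.
  by apply: le_trans (expR_ge1Dx _); rewrite lerD2l ler_piMl.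
apply: le_trans (expR_quadratic_le Mhalf) _.
have : sqnorm M * sqnorm M <= sqnorm M * (1 / 2).
  by rewrite ler_wpM2l ?sqnorm_ge0.
lra.
Qed.

End fixed_dimensions.

(** * The asymptotic regime *)

Section asymptotics.
Context {R : realType}.

Lemma square_le_of_le_cube_root (k m : nat) : (0 < k)%N ->
  k%:R <= m%:R `^ (3^-1) :> R -> (k ^ 2 <= m)%N.
Proof.
move=> k0 km.
have k3 : (k ^ 3 <= m)%N.
  rewrite -(ler_nat R) natrX.
  have -> : m%:R = (m%:R `^ (3^-1)) ^+ 3 :> R.
    by rewrite -powR_mulrn ?powR_ge0// -powRrM mulVf// powRr1.
  by rewrite lerXn2r ?nnegrE ?powR_ge0 ?ler0n.
by apply: leq_trans k3; rewrite leq_pexp2l.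
Qed.

(** The constraint on k forces sqrt k m / n to be less than min (1, a) ^ 2 / 4, so a
    bound on rho ^ 2 relative to it also makes rho small and 2 rho at most a. The
    last bound is kappa <= eta for x = p (2 rho) ^ 2. *)
Lemma regime_constants (n m k : nat) (a rho eta : R) :
  (0 < m)%N -> (0 < k)%N -> 0 < eta -> eta <= 1 / 200 -> 0 < rho -> 0 < a ->
  k%:R `^ (4^-1) * Num.sqrt (m%:R / n%:R) < Num.min 1 a / 2 ->
  rho ^+ 2 <= eta / 16 * (Num.sqrt k%:R * m%:R / n%:R) ->
  [/\ 2 * rho <= a, 64 * rho ^+ 2 <= eta &
    (@sampling_rate R m n * (2 * rho) ^+ 2) ^+ 2 * m%:R ^+ 2 <= eta * k%:R].
Proof.
move=> m0 k0 eta0 eta200 rho0 a0 klt rhoq.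
pose z : R := Num.sqrt k%:R * m%:R / n%:R.
have mR : 0 < m%:R :> R by rewrite ltr0n.
have z0 : 0 <= z by rewrite !mulr_ge0 ?sqrtr_ge0 ?invr_ge0 ?ler0n.
have zlt : z < (Num.min 1 a / 2) ^+ 2.
  have -> : z = (k%:R `^ (4^-1) * Num.sqrt (m%:R / n%:R)) ^+ 2.
    rewrite exprMn sqr_sqrtr ?divr_ge0 ?ler0n// -powR_mulrn ?powR_ge0// -powRrM.
    have -> : 4^-1 * 2%:R = 2^-1 :> R by field.
    by rewrite powR12_sqrt ?ler0n// /z -mulrA.
  have lhs0 : 0 <= k%:R `^ (4^-1) * Num.sqrt (m%:R / n%:R) :> R.
    by rewrite mulr_ge0 ?powR_ge0 ?sqrtr_ge0.
  have rhs0 : 0 <= Num.min 1 a / 2 by apply: ltW (le_lt_trans lhs0 klt).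
  by rewrite ltr_sqr ?nnegrE.
have min1 : Num.min 1 a <= 1 by rewrite ge_min lexx.
have mina : Num.min 1 a <= a by rewrite ge_min lexx orbT.
have min0 : 0 < Num.min 1 a by rewrite lt_min ltr01.
have z1 : z <= 1 / 4.
  apply: (le_trans (ltW zlt)).
  have : Num.min 1 a * Num.min 1 a <= 1 * 1 by apply: ler_pM => //; exact: ltW.
  by move: (Num.min 1 a) => u; lra.
have za : 4 * z <= a ^+ 2.
  have : Num.min 1 a * Num.min 1 a <= a * a by apply: ler_pM => //; exact: ltW.
  by move: zlt; move: (Num.min 1 a) => u; lra.
have etaz : eta / 16 * z <= 1 / 16 * z by rewrite ler_wpM2r//; lra.
have etaz' : eta / 16 * z <= eta / 16 * (1 / 4) by rewrite ler_wpM2l// divr_ge0// ltW.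
rewrite -/z in rhoq; split.
- have h : (2 * rho) ^+ 2 <= a ^+ 2 by have := sqr_ge0 a; lra.
  move: h; rewrite ler_sqr// nnegrE; last exact: ltW.
  by rewrite mulr_ge0// ltW.
- lra.
have nz : n%:R * z <= Num.sqrt k%:R * m%:R.
  have [->|n0] := eqVneq n 0%N; first by rewrite mul0r mulr_ge0 ?sqrtr_ge0 ?ler0n.
  by rewrite /z mulrC divfK// pnatr_eq0.
have bound : n%:R * (2 * rho) ^+ 2 <= eta / 4 * (Num.sqrt k%:R * m%:R).
  apply: (le_trans (_ : _ <= n%:R * (4 * (eta / 16 * z)))).
    by rewrite ler_wpM2l ?ler0n//; lra.
  have -> : n%:R * (4 * (eta / 16 * z)) = eta / 4 * (n%:R * z) by field.
  by rewrite ler_wpM2l// divr_ge0// ltW.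
have -> : (@sampling_rate R m n * (2 * rho) ^+ 2) ^+ 2 * m%:R ^+ 2 =
    (n%:R * (2 * rho) ^+ 2) ^+ 2 / m%:R ^+ 2.
  by rewrite /sampling_rate; field; rewrite gt_eqF.
rewrite ler_pdivrMr ?exprn_gt0//.
apply: (le_trans (_ : _ <= (eta / 4 * (Num.sqrt k%:R * m%:R)) ^+ 2)).
  rewrite ler_sqr// nnegrE; first by rewrite mulr_ge0 ?ler0n ?sqr_ge0.
  by apply: le_trans bound; rewrite mulr_ge0 ?ler0n ?sqr_ge0.
have -> : (eta / 4 * (Num.sqrt k%:R * m%:R)) ^+ 2 = eta ^+ 2 / 16 * k%:R * m%:R ^+ 2.
  by rewrite !exprMn sqr_sqrtr ?ler0n//; field.
rewrite ler_wpM2r ?sqr_ge0// ler_wpM2r ?ler0n//.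
have : eta * eta <= eta * (1 / 200) by rewrite ler_wpM2l// ltW.
lra.
Qed.

Lemma limf_einf_ge1 (F : set_system (nat * nat)) (f : nat * nat -> \bar R) :
  (forall e : R, 0 < e -> \forall x \near F, ((1 - e)%:E <= f x)%E) ->
  (1 <= limf_einf f F)%E.
Proof.
move=> h; rewrite limf_einfE; apply/lee_subgt0Pr => e e0.
apply: le_trans (_ : ((1 - e)%:E <= ereal_inf (f @` [set x | ((1 - e)%:E <= f x)%E]))%E) _.
  by apply/ereal_infP => _ [x fx <-].
apply: ereal_sup_ubound; exists [set x | ((1 - e)%:E <= f x)%E] => //.
exact: h.
Qed.

Lemma regime_limf_esup_ge0 (D : set (nat * nat)) (f : nat * nat -> \bar R) :
  (forall N, exists2 nm, D nm & (N <= minn nm.1 nm.2)%N) ->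
  (forall nm, (0 <= f nm)%E) -> (0 <= limf_esup f (regime D))%E.
Proof.
move=> Dinf f0; apply/ereal_infP => _ [V [N _ NV] <-].
have [nm Dnm Nnm] := Dinf N.
apply: le_trans (f0 nm) _; apply: ereal_sup_ubound; exists nm => //.
exact: NV.
Qed.

End asymptotics.

Theorem theorem5p2 (R : realType) (a U : R) (D : set (nat * nat))
    (k k0 : nat * nat -> nat) (rho : nat * nat -> R)
    (a_gt0 : 0 < a) (U_ge2 : 2 <= U)
    (D_unbounded : forall N, exists2 nm, D nm & (N <= minn nm.1 nm.2)%N)
    (n_le : forall nm, D nm -> (nm.1 <= nm.2 ^ 2)%N)
    (k_gt0 : forall nm, D nm -> (0 < k nm)%N)
    (k_le : forall nm, D nm -> (k nm)%:R <= (nm.2)%:R `^ (3^-1) :> R)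
    (k_lt : forall nm, D nm ->
      (k nm)%:R `^ (4^-1) * Num.sqrt ((nm.2)%:R / (nm.1)%:R) < Num.min 1 a / 2)
    (k_infty : k nm @[nm --> regime D] --> \oo)
    (k0_lt : forall nm, D nm -> (k0 nm < k nm)%N)
    (k0_o : (fun nm => (k0 nm)%:R : R) =o_ (regime D) (fun nm => (k nm)%:R : R))
    (rho_in : forall nm, D nm -> 0 < rho nm < 1 / 2)
    (rho_o : (fun nm => rho nm ^+ 2) =o_ (regime D)
      (fun nm => Num.sqrt (k nm)%:R * (nm.2)%:R / (nm.1)%:R : R)) :
  (forall Psi : forall nm : nat * nat, 'M[R * bool]_nm.2 -> bool,
    (forall nm, is_test (Psi nm)) ->
    (1 <= limf_einf (fun nm : nat * nat => testing_risk nm.1 U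
        (null_hypothesis nm.2 a (k0 nm))
        (alternative_hypothesis nm.2 a (k0 nm) (k nm) (rho nm))
        (Psi nm)) (regime D))%E) /\
  (forall (tau : R) (Sigma : set R),
    tau%:E = limf_esup (fun nm : nat * nat =>
      ((k nm)%:R `^ (4^-1) * Num.sqrt ((nm.2)%:R / (nm.1)%:R))%:E)
      (regime D) ->
    Sigma `<=` [set` `]0, U]] ->
    [set` `[Num.sqrt (1 - 4 * tau), 1]] `<=` Sigma ->
    testing_lower_bound U (regime D)
      (fun nm => bounded_low_rank a (k nm) `*` Sigma)
      (fun nm => bounded_low_rank a (k0 nm) `*` Sigma)
      rho 1).
Proof.
have key (e : R) : 0 < e -> \forall nm \near regime D, exists eta : R,
    [/\ D nm, 0 < eta, eta <= 1 / 200, 20 * eta <= e ^+ 2 &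
     [/\ (0 < nm.2)%N, (k nm ^ 2 <= nm.2)%N, (k0 nm)%:R <= eta * (k nm)%:R &
      [/\ 2 * rho nm <= a, 64 * rho nm ^+ 2 <= eta &
        (@sampling_rate R nm.2 nm.1 * (2 * rho nm) ^+ 2) ^+ 2 * nm.2%:R ^+ 2 <=
        eta * (k nm)%:R]]].
  (* The second moment is at most 1 + 20 eta. *)
  move=> e0; pose eta := Num.min (e ^+ 2 / 20) (1 / 200).
  have eta0 : 0 < eta by rewrite lt_min divr_gt0 ?exprn_gt0//=; lra.
  have eta1 : eta <= 1 / 200 by rewrite ge_min lexx orbT.
  have eta2 : eta <= e ^+ 2 / 20 by rewrite ge_min lexx.
  have D_near : \forall nm \near regime D, D nm.
    by exists 0%N.
  have k0_near := (eqoP _ _ _).1 k0_o eta eta0.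
  have eta16 : 0 < eta / 16 by rewrite divr_gt0.
  have rho_near := (eqoP _ _ _).1 rho_o (eta / 16) eta16.
  near=> nm; exists eta.
  have Dnm : D nm by near: nm.
  have k2 := square_le_of_le_cube_root (k_gt0 nm Dnm) (k_le nm Dnm).
  have m0 : (0 < nm.2)%N by apply: leq_trans k2; rewrite expn_gt0 k_gt0.
  have /andP[rho0 _] := rho_in nm Dnm.
  split => //; first by lra.
  split => //.
    have : `|(k0 nm)%:R : R| <= eta * `|(k nm)%:R : R| by near: nm.
    by rewrite !normr_nat.
  apply: regime_constants => //; first exact: k_gt0.
    exact: k_lt.
  have : `|rho nm ^+ 2| <= eta / 16 * `|Num.sqrt (k nm)%:R * (nm.2)%:R / (nm.1)%:R|.
    by near: nm.
  by rewrite ger0_norm ?sqr_ge0// [X in _ * X]ger0_norm//.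
split.
  move=> Psi _; apply: limf_einf_ge1 => e e0.
  apply: filterS (key e e0) => nm [eta [Dnm eta0 eta1 eta2 [m0 k2 k0k [rhoa _ xm]]]].
  have kS := prednK (k_gt0 nm Dnm).
  rewrite -kS in k2 k0k xm *.
  apply: (unknown_variance_risk (eta := eta)) => //; first exact: n_le.
  exact: rho_in.
move=> tau Sigma tauE SigmaU Sigma_itv; split => //.
have tau0 : 0 <= tau.
  by rewrite -lee_fin tauE; apply: regime_limf_esup_ge0.
have Sigma1 : Sigma 1.
  apply: Sigma_itv; rewrite /= in_itv /= lexx andbT -[leRHS]sqrtr1 ler_wsqrtr//.
  by lra.
apply: limf_einf_ge1 => e e0.
apply: filterS (key e e0) => nm [eta [Dnm eta0 eta1 eta2 [m0 k2 k0k [rhoa rho64 xm]]]].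
apply/ereal_infP => _ [Psi _ <-].
have /andP[rho0 rho12] := rho_in nm Dnm.
have mR : 1 <= nm.2%:R :> R by rewrite ler1n.
have kS := prednK (k_gt0 nm Dnm).
set k' := (k nm).-1 in kS; rewrite -kS in k2 k0k.
have km : (k'.+1 <= nm.2)%N by apply: leq_trans k2; rewrite expnS expn1 leq_pmulr.
have [w Sw] : exists w : prior_index nm.2 k', spread (R := R) (k0 nm) w.
  apply/existsP; apply: contraT; rewrite negb_exists => /forallP none.
  have := spread_fraction m0 km k0k.
  rewrite (_ : mean _ = 0); first by lra.
  rewrite /mean big1 ?mul0r// => o _.
  by rewrite (negbTE (none o)).
(* At this scale the bound of spread_distance is rho. *)
pose s := 2 * rho nm / nm.2%:R.
have s0 : 0 <= s by rewrite divr_ge0// mulr_ge0// ltW.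
have s2rho : s <= 2 * rho nm.
  by rewrite ler_pdivrMr ?(lt_le_trans ltr01)// ler_peMr// mulr_ge0// ltW.
have norm2 : sqnorm (s *: sign_matrix (R := R) w) = 4 * rho nm ^+ 2.
  rewrite /sqnorm; under eq_bigr do under eq_bigr do
    rewrite mxE exprMn sign_matrix_sq mulr1.
  rewrite !sumr_const !card_ord -[LHS]mulr_natr -[X in X * _]mulr_natr /s; field.
  by rewrite gt_eqF// (lt_le_trans ltr01).
apply: (@known_variance_risk R _ _ U e _ _ (s *: sign_matrix w)) => //.
- exact: n_le.
- by move=> i j; rewrite mxE normrM sign_matrix_norm mulr1 ger0_norm//; lra.
- by rewrite norm2; lra.
- by rewrite norm2; lra.
- by split => //; apply: zero_bounded_low_rank; exact: ltW.
split.
  split => //=; rewrite -kS; apply: scaled_sign_matrix_bounded.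
  by rewrite s0 (le_trans s2rho).
apply: le_dist_to.
  by exists (0, 1); split => //; apply: zero_bounded_low_rank; exact: ltW.
move=> [A sig] [/= [_ Ak] _]; rewrite /param_dist /=.
apply: frobenius_dist_ge; first exact: ltW.
have -> : rho nm = s * nm.2%:R / 2.
  by rewrite /s; field; rewrite gt_eqF// (lt_le_trans ltr01).
exact: (spread_distance s0 Sw Ak).
Unshelve. all: by end_near.
Qed.
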